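(* Let $M\subset A^r$ be a finitely generated graded right $A$-submodule with minimal homogeneous basis $g_1,\dots,g_s$, $\Delta_j=\deg g_j$, let $\varphi:\bigoplus_{j=1}^sA[-\Delta_j]\to A^r$, $\epsilon_j\mapsto g_j$, and $\varphi'=L(\varphi):\bigoplus_jS[-\Delta_j]\to S^r$, $\epsilon'_j\mapsto\iota(g_j)$. Let $K=\mathrm{Ker}\,\varphi$ (the right syzygies of $\{g_j\}$), $K'=\mathrm{Ker}\,\varphi'$, and let $C\subset\bigoplus_jS[-\Delta_j]$ be the $S$-submodule generated by the elements $\epsilon'_jx_{kl}$ with $1\le j\le s$, $1\le k\le n$, $1\le l\le\Delta_j$. Then $K'=C+L(K)$, and $b_d(K)=b_d(K')-b_d(C)$ for all $d\ge0$.
   Context: Let $\mathbb K$ be a field, $F=\mathbb K\langle x_1,\dots,x_n\rangle$ with standard grading, $I\subset F$ a graded two-sided ideal, $A=F/I$, $A[-\delta]_d=A_{d-\delta}$; $A^r$ has basis $e_i$ of degree $0$ and $\bigoplus_jA[-\Delta_j]$ has basis $\epsilon_j$ of degree $\Delta_j$. Minimal basis: homogeneous generating set none of whose elements lies in the submodule generated by the others; $b_d$ = number of degree-$d$ elements in a minimal homogeneous basis. Let $P=\mathbb K[x_{ij}\mid1\le i\le n,j\ge1]$ (commutative, $\deg x_{ij}=1$), $Q$ the ideal generated by all $x_{ij}x_{kj}$, $R=P/Q$, $\sigma:x_{ij}\mapsto x_{i,j+1}$, $\iota:F\to R$ the $\mathbb K$-linear map $x_{i_1}\cdots x_{i_d}\mapsto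 x_{i_11}\cdots x_{i_dd}$, $J$ the ideal generated by $\bigcup_{k\ge0}\sigma^k(\iota(I))$, $S=R/J$ (with induced $\sigma$ and induced injective linear $\iota:A\to S$); $x_{kl}$ also denotes its coset in $S$. $S^r$ and $\bigoplus_jS[-\Delta_j]$ are free $S$-modules with bases $e'_i$ (degree $0$) and $\epsilon'_j$ (degree $\Delta_j$). The module letterplace embedding of a graded free module $\bigoplus_iA[-\delta_i]$ into $\bigoplus_iS[-\delta_i]$ is $e_if\mapsto e'_i\sigma^{\delta_i}(\iota(f))$; for a graded right submodule $N$, $L(N)$ is the $S$-submodule generated by $\iota(N)$. *)

(* Defs.v *)
From HB Require Import structures.
From mathcomp Require Import all_boot all_order all_algebra.
Set Implicit Arguments. Unset Strict Implicit. Unset Printing Implicit Defensive.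
Import GRing.Theory.
Local Open Scope ring_scope.

Section LetterPlace.
Variable k : fieldType.

(* an element is a finite list of (coefficient, monomial) pairs; eqm tells
   when two monomial representatives denote the same monomial. *)
Definition coef {X : Type} (eqm : rel X) (p : seq (k * X)) (m : X) : k :=
  \sum_(t <- p | eqm t.2 m) t.1.
Definition lc_eq {X : Type} (eqm : rel X) (p q : seq (k * X)) :=
  forall m, coef eqm p m = coef eqm q m.
Definition lc_scale {X : Type} (c : k) (p : seq (k * X)) : seq (k * X) :=
  [seq (c * t.1, t.2) | t <- p].
Definition lc_sub {X : Type} (p q : seq (k * X)) : seq (k * X) :=
  p ++ lc_scale (-1) q.
Definition lc_mul {X Y Z : Type} (act : X -> Y -> Z)
    (p : seq (k * X)) (q : seq (k * Y)) : seq (k * Z) :=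
  [seq (t.1 * u.1, act t.2 u.2) | t <- p, u <- q].
Definition homog {X : Type} (eqm : rel X) (deg : X -> nat) (d : nat)
    (p : seq (k * X)) :=
  forall m, coef eqm p m != 0 -> deg m = d.
Definition comp {Ix : eqType} {X : Type} (i : Ix) (p : seq (k * (Ix * X)))
  : seq (k * X) := [seq (t.1, t.2.2) | t <- p & t.2.1 == i].

Variable n : nat.

Definition word := seq 'I_n.
Definition weq : rel word := fun a b => a == b.
Definition hcomp (d : nat) (p : seq (k * word)) := [seq t <- p | size t.2 == d].

Definition is_graded_ideal (I : seq (k * word) -> Prop) :=
  [/\ (forall p q, lc_eq weq p q -> I p -> I q) /\
      I [::],
      forall p q, I p -> I q -> I (p ++ q),
      forall c p, I p -> I (lc_scale c p),
      forall f p, I p -> I (lc_mul cat f p) /\ I (lc_mul cat p f)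
    & forall p d, I p -> I (hcomp d p)].

Variable I : seq (k * word) -> Prop.

(* free right A-modules (A = F/I) with basis indexed by Ix:
   an element is a combination of monomials e_i w *)
Definition feq {Ix : eqType} : rel (Ix * word) := fun a b => a == b.
Definition modI {Ix : eqType} (p q : seq (k * (Ix * word))) :=
  forall i : Ix, I (comp i (lc_sub p q)).
Definition rmulF {Ix : eqType} (p : seq (k * (Ix * word))) (f : seq (k * word)) :=
  lc_mul (fun (x : Ix * word) w => (x.1, x.2 ++ w)) p f.

Inductive rspanA {Ix : eqType} (G : seq (k * (Ix * word)) -> Prop)
  : seq (k * (Ix * word)) -> Prop :=
| rsA_gen p : G p -> rspanA G p
| rsA_zero : rspanA G [::]
| rsA_add p q : rspanA G p -> rspanA G q -> rspanA G (p ++ q)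
| rsA_mul p f : rspanA G p -> rspanA G (rmulF p f)
| rsA_equiv p q : rspanA G p -> modI p q -> rspanA G q.

(* homogeneous of degree d in the graded free module (+)_i A[-Delta_i]
   (the class contains a homogeneous representative) *)
Definition hdegA {Ix : eqType} (Delta : Ix -> nat) (d : nat)
    (p : seq (k * (Ix * word))) :=
  exists q, modI p q /\ homog feq (fun x => Delta x.1 + size x.2) d q.

(* the variable (i, j) stands for x_{i+1, j+1} (i : 'I_n, j : nat) *)
Definition var := ('I_n * nat)%type.
(* commutative monomials: multisets of variables *)
Definition cmon := seq var.
Definition ceq : rel cmon := fun a b => perm_eq a b.

Inductive ideal_gen (G : seq (k * cmon) -> Prop) : seq (k * cmon) -> Prop :=
| ig_gen p : G p -> ideal_gen G p
| ig_zero : ideal_gen G [::]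
| ig_add p q : ideal_gen G p -> ideal_gen G q -> ideal_gen G (p ++ q)
| ig_mul f p : ideal_gen G p -> ideal_gen G (lc_mul cat f p)
| ig_equiv p q : ideal_gen G p -> lc_eq ceq p q -> ideal_gen G q.

(* sigma^s (iota w) : the monomial x_{w_1, 1+s} ... x_{w_d, d+s} *)
Definition lpmon (s : nat) (w : word) : cmon :=
  [seq (x.1, x.2 + s) | x <- zip w (iota 0 (size w))].
Definition iotaP (s : nat) (f : seq (k * word)) : seq (k * cmon) :=
  [seq (t.1, lpmon s t.2) | t <- f].

Definition QG (p : seq (k * cmon)) :=
  exists (i l : 'I_n) (j : nat), p = [:: (1, [:: (i, j); (l, j)])].
(* the ideal Q + (sigma^s iota(I), s >= 0) of P, so that S = P / SI *)
Definition SI := ideal_gen (fun p => QG p \/ exists f s, I f /\ p = iotaP s f).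

Definition meq {Ix : eqType} : rel (Ix * cmon) :=
  fun a b => (a.1 == b.1) && perm_eq a.2 b.2.
Definition modS {Ix : eqType} (p q : seq (k * (Ix * cmon))) :=
  forall i : Ix, SI (comp i (lc_sub p q)).
Definition rmulS {Ix : eqType} (p : seq (k * (Ix * cmon))) (f : seq (k * cmon)) :=
  lc_mul (fun (x : Ix * cmon) m => (x.1, x.2 ++ m)) p f.

Inductive sspan {Ix : eqType} (G : seq (k * (Ix * cmon)) -> Prop)
  : seq (k * (Ix * cmon)) -> Prop :=
| ss_gen p : G p -> sspan G p
| ss_zero : sspan G [::]
| ss_add p q : sspan G p -> sspan G q -> sspan G (p ++ q)
| ss_mul p f : sspan G p -> sspan G (rmulS p f)
| ss_equiv p q : sspan G p -> modS p q -> sspan G q.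

Definition hdegS {Ix : eqType} (Delta : Ix -> nat) (d : nat)
    (p : seq (k * (Ix * cmon))) :=
  exists q, modS p q /\ homog meq (fun x => Delta x.1 + size x.2) d q.

Variables (r s : nat) (g : 'I_s -> seq (k * ('I_r * word))) (Delta : 'I_s -> nat).

Definition phiA (p : seq (k * ('I_s * word))) : seq (k * ('I_r * word)) :=
  flatten [seq [seq (t.1 * u.1, (u.2.1, u.2.2 ++ t.2.2)) | u <- g t.2.1] | t <- p].
Definition kerA (p : seq (k * ('I_s * word))) := modI (phiA p) [::].

(* iota on A^r (shift 0) and on (+)_j A[-Delta_j] (shift Delta_j) *)
Definition iotaM {Ix : eqType} (D : Ix -> nat) (p : seq (k * (Ix * word)))
  : seq (k * (Ix * cmon)) := [seq (t.1, (t.2.1, lpmon (D t.2.1) t.2.2)) | t <- p].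

Definition phiS (p : seq (k * ('I_s * cmon))) : seq (k * ('I_r * cmon)) :=
  flatten [seq [seq (t.1 * u.1, (u.2.1, u.2.2 ++ t.2.2))
               | u <- iotaM (fun _ => 0%N) (g t.2.1)] | t <- p].
Definition kerS (p : seq (k * ('I_s * cmon))) := modS (phiS p) [::].

Definition LK := sspan (fun q => exists2 p, kerA p & q = iotaM Delta p).
(* C : generated by eps'_j x_{kl}, 1 <= l <= Delta_j  (l-1 = c below) *)
Definition Cmod := sspan (fun q =>
  exists (j : 'I_s) (i : 'I_n) (c : nat), (c < Delta j)%N /\
     q = [:: (1, (j, [:: (i, c)]))]).

End LetterPlace.

Definition min_hbasis {E : eqType} (span : (E -> Prop) -> E -> Prop)
    (hdeg : nat -> E -> Prop) (N B : E -> Prop) :=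
  [/\ forall p, N p <-> span B p,
      forall b, B b -> exists d, hdeg d b
    & forall b, B b -> ~ span (fun c => B c /\ c <> b) b].

Definition bcount {E : eqType} (hdeg : nat -> E -> Prop) (B : E -> Prop)
    (d m : nat) :=
  exists l : seq E, [/\ uniq l, forall x, x \in l <-> (B x /\ hdeg d x)
                      & size l = m].

(* Main.v *)
Require Import Defs.
From HB Require Import structures.
From mathcomp Require Import all_boot all_order all_algebra zify.
From Stdlib Require Import Classical.
Set Implicit Arguments. Unset Strict Implicit. Unset Printing Implicit Defensive.
Import GRing.Theory.
Local Open Scope ring_scope.

(** Grade S by columns: Q kills every monomial in which a column is repeated, and the relations
    sigma^k(iota f) only involve runs of consecutive columns.  If no column up to Delta_j occurs in
    a monomial epsilon'_j u (otherwise it lies in C), let m be the first column that is missing after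
    Delta_j.  Then u is a word w placed in columns Delta_j + 1, .., m - 1 times a monomial in columns
    beyond m, and in S no relation crosses the missing column m.  A functional on words of length m - 1
    that vanishes on I therefore extends to a linear endomorphism of S acting on the head of a monomial, and
    applying these functionals to phi'(p) = 0 shows that the heads of p solve, modulo the tails, the
    linear system that defines K: hence K' = C + L(K).

    For the counts, b_d(N) is the dimension of (N / N S_+)_d, by Nakayama.  The map that keeps the
    monomials with a column up to Delta_j and the map that reads a monomial back as a word send
    K' S_+ into C S_+ and K A_+ respectively.  Hence iota of a minimal basis of K together with a
    minimal basis of C is a basis of K' / K' S_+. *)

(** * Linear combinations given by lists *)

(** The linear system behind K' = C + L(K) has scalar coefficients, but its unknowns are tails,
    which live in S, where no basis is at hand. A generalized inverse rho of the matrix Psi, with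
    Psi rho Psi = Psi, solves it without one: a row u of tails with u Psi = 0 equals u (1 - Psi
    rho), and the rows of 1 - Psi rho are scalar solutions, that is, elements of K. The count rests
    on the minimality of the g_j. If a syzygy had a constant term at epsilon_j, multiplying its
    image by x_{kl} with l at most Delta_j would put the generator epsilon'_j x_{kl} of C itself
    into the low part, and K' S_+ would not be sent into C S_+. Columns are numbered from 0 in the
    code. Hence [m] is at once the first missing column and the length of a complete head, the word
    of g_j included. No quotient is ever formed: A, S and their free modules are lists modulo a null
    space, and homogeneity, independence and spanning are all understood modulo such a subspace. *)

Section LinearCombinations.
Variable k : fieldType.

(** Lists are compared only through the functionals that they induce. An identity between
    combinations becomes an identity between scalars, and no normal form of a list is required. *)
Definition ev {X : Type} (p : seq (k * X)) (h : X -> k) : k :=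
  foldr (fun t s => t.1 * h t.2 + s) 0 p.
Lemma evE X (p : seq (k * X)) h : ev p h = \sum_(t <- p) t.1 * h t.2.
Proof. by elim: p => [|t p IH]; rewrite ?big_nil //= big_cons -IH. Qed.
Arguments ev : simpl never.
Definition invar {X Y : Type} (e : rel X) (h : X -> Y) :=
  forall x y, e x y -> h x = h y.

Lemma ev_nil X (h : X -> k) : ev [::] h = 0. Proof. by []. Qed.
Lemma ev_cons X (t : k * X) p h : ev (t :: p) h = t.1 * h t.2 + ev p h.
Proof. by []. Qed.
Lemma ev1 X c (x : X) h : ev [:: (c, x)] h = c * h x.
Proof. by rewrite ev_cons ev_nil addr0. Qed.
Lemma ev_cat X (p q : seq (k * X)) h : ev (p ++ q) h = ev p h + ev q h.
Proof. by rewrite !evE big_cat. Qed.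
Lemma ev_flatten X (L : seq (seq (k * X))) h :
  ev (flatten L) h = \sum_(p <- L) ev p h.
Proof. by elim: L => [|p L IH]; rewrite ?big_nil ?ev_nil //= big_cons ev_cat IH. Qed.
Lemma ev_scale X c (p : seq (k * X)) h : ev (lc_scale c p) h = c * ev p h.
Proof.
by rewrite !evE big_map mulr_sumr; apply: eq_bigr => t _; rewrite mulrA.
Qed.
Lemma ev_sub X (p q : seq (k * X)) h : ev (lc_sub p q) h = ev p h - ev q h.
Proof. by rewrite ev_cat ev_scale mulN1r. Qed.
Lemma eq_ev X (p : seq (k * X)) h h' : h =1 h' -> ev p h = ev p h'.
Proof. by move=> hh; rewrite !evE; apply: eq_bigr => t _; rewrite hh. Qed.
Lemma eq_ev_all X (P : pred X) (p : seq (k * X)) h h' :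
  all (fun t => P t.2) p -> (forall x, P x -> h x = h' x) -> ev p h = ev p h'.
Proof.
move=> + hh; elim: p => [|t p IH] /=; first by rewrite !ev_nil.
by case/andP=> Pt Pp; rewrite !ev_cons hh // IH.
Qed.
Lemma ev_map X Y (f : X -> Y) (p : seq (k * X)) h :
  ev [seq (t.1, f t.2) | t <- p] h = ev p (h \o f).
Proof. by rewrite !evE big_map. Qed.
Lemma ev_filter X (P : pred X) (p : seq (k * X)) h :
  ev [seq t <- p | P t.2] h = ev p (fun x => if P x then h x else 0).
Proof.
rewrite !evE big_filter big_mkcond; apply: eq_bigr => t _.
by case: ifP; rewrite ?mulr0.
Qed.
Lemma ev_mulr X (p : seq (k * X)) h c : ev p (fun x => h x * c) = ev p h * c.
Proof. by rewrite !evE mulr_suml; apply: eq_bigr => t _; rewrite mulrA. Qed.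
Lemma ev_mull X (p : seq (k * X)) h c : ev p (fun x => c * h x) = c * ev p h.
Proof. by rewrite mulrC -ev_mulr; apply: eq_ev => x; rewrite mulrC. Qed.
Lemma ev_zero X (p : seq (k * X)) h : (forall x, h x = 0) -> ev p h = 0.
Proof. by move=> h0; rewrite !evE big1 // => t _; rewrite h0 mulr0. Qed.
Lemma ev_add X (p : seq (k * X)) h h' :
  ev p (fun x => h x + h' x) = ev p h + ev p h'.
Proof.
by rewrite !evE -big_split; apply: eq_bigr => t _; rewrite mulrDr.
Qed.
Lemma ev_sum X J (r : seq J) (P : pred J) (p : seq (k * X)) (h : J -> X -> k) :
  ev p (fun x => \sum_(j <- r | P j) h j x) = \sum_(j <- r | P j) ev p (h j).
Proof.
elim: p => [|t p IH]; first by rewrite ev_nil big1.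
by rewrite ev_cons IH mulr_sumr -big_split; apply: eq_bigr => j _; rewrite ev_cons.
Qed.
Lemma ev_exchange X Y (p : seq (k * X)) (q : seq (k * Y)) (h : X -> Y -> k) :
  ev p (fun x => ev q (h x)) = ev q (fun y => ev p (h^~ y)).
Proof.
elim: p => [|t p IH]; first by rewrite ev_nil ev_zero.
by rewrite ev_cons IH -ev_mull -ev_add.
Qed.
Lemma ev_lc_mul X Y Z (act : X -> Y -> Z) p q h :
  ev (lc_mul act p q) h = ev p (fun x => ev q (fun y => h (act x y))).
Proof.
rewrite !evE /lc_mul big_allpairs_dep /=; apply: eq_bigr => t _; rewrite evE mulr_sumr.
by apply: eq_bigr => u _; rewrite /= mulrA.
Qed.
Lemma ev_comp (Ix : eqType) X (i : Ix) (p : seq (k * (Ix * X))) h :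
  ev (Defs.comp i p) h = ev p (fun x => if x.1 == i then h x.2 else 0).
Proof.
rewrite !evE big_map big_filter big_mkcond; apply: eq_bigr => t _.
by case: ifP; rewrite ?mulr0.
Qed.
Lemma ev_if X (b : bool) (p : seq (k * X)) h :
  ev p (fun x => if b then h x else 0) = if b then ev p h else 0.
Proof. by case: b => //; apply: ev_zero. Qed.

Lemma coef_ev X (e : rel X) p m : coef e p m = ev p (fun x => (e x m)%:R).
Proof.
rewrite evE /coef big_mkcond; apply: eq_bigr => t _.
by case: (e t.2 m); rewrite ?mulr1 ?mulr0.
Qed.

Definition lin {X Y : Type} (f : X -> seq (k * Y)) (p : seq (k * X)) :=
  flatten [seq lc_scale t.1 (f t.2) | t <- p].
Lemma ev_lin X Y (f : X -> seq (k * Y)) p h : ev (lin f p) h = ev p (fun x => ev (f x) h).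
Proof. by rewrite ev_flatten big_map evE; apply: eq_bigr => t _; rewrite ev_scale. Qed.

Definition comb (J : finType) X (c : J -> k) (v : J -> seq (k * X)) :=
  flatten [seq lc_scale (c j) (v j) | j <- enum J].
Lemma ev_comb (J : finType) X (c : J -> k) (v : J -> seq (k * X)) h :
  ev (comb c v) h = \sum_j c j * ev (v j) h.
Proof.
by rewrite ev_flatten big_map -big_enum; apply: eq_bigr => j _; rewrite ev_scale.
Qed.

Section Equivalence.
Variables (X : Type) (e : rel X).
Hypothesis eqe : equivalence_rel e.

Lemma erefl_rel x : e x x. Proof. by have [] := eqe x x x. Qed.
Lemma invar_eqr m : invar e (fun x => (e x m)%:R : k).
Proof. by move=> x y exy; have [_ /(_ exy) ->] := eqe x y m. Qed.

(** The terms equivalent to the first monomial contribute its coefficient, which is zero, times the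
    common value of [h]. Deleting this whole class shortens the list and leaves all coefficients
    zero. *)
Lemma ev_coef0 (p : seq (k * X)) h : (forall m, coef e p m = 0) -> invar e h -> ev p h = 0.
Proof.
move=> + ih; elim: {p}(size p) {-2}p (leqnn (size p)) => [|N IH] [|t p] //= sp p0;
  rewrite ?ev_nil //.
pose q := [seq u <- p | ~~ e u.2 t.2].
have cls f : invar e f -> ev (t :: p) f = coef e (t :: p) t.2 * f t.2 + ev q f.
  move=> fi; rewrite coef_ev !ev_cons erefl_rel mulr1 mulrDl -addrA; congr (_ + _).
  rewrite (ev_filter (fun x => ~~ e x t.2)) -ev_mulr -ev_add; apply: eq_ev => x.
  by case: (boolP (e x t.2)) => [/fi ->|_]; rewrite ?mul1r ?addr0 ?mul0r ?add0r.
rewrite cls // p0 mul0r add0r IH // => [|m].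
  by rewrite size_filter (leq_trans (count_size _ _)).
have := cls _ (invar_eqr m); rewrite -coef_ev p0 p0 mul0r add0r -coef_ev => <- //.
Qed.

Lemma lc_eqP (p q : seq (k * X)) :
  lc_eq e p q <-> (forall h, invar e h -> ev p h = ev q h).
Proof.
split=> [pq h ih|H m]; last by rewrite !coef_ev; apply/H/invar_eqr.
apply/eqP; rewrite -subr_eq0 -ev_sub; apply/eqP/ev_coef0 => // m.
by rewrite coef_ev ev_sub -!coef_ev pq subrr.
Qed.
Lemma lc_eqW (p q : seq (k * X)) : (forall h, invar e h -> ev p h = ev q h) -> lc_eq e p q.
Proof. by move/lc_eqP. Qed.

End Equivalence.

Record subsp {X : Type} (e : rel X) (N : seq (k * X) -> Prop) : Prop := Subsp {
  sub_nil : N [::];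
  sub_cat : forall p q, N p -> N q -> N (p ++ q);
  sub_scale : forall c p, N p -> N (lc_scale c p);
  sub_eq : forall p q, lc_eq e p q -> N p -> N q }.

Section Subspace.
Variables (X : Type) (e : rel X) (N : seq (k * X) -> Prop).
Hypotheses (eqe : equivalence_rel e) (sN : subsp e N).

Lemma sub_sub p q : N p -> N q -> N (lc_sub p q).
Proof. by move=> Np Nq; apply: (sub_cat sN) => //; apply: (sub_scale sN). Qed.
Lemma sub_ev (p q : seq (k * X)) : N p -> (forall h, invar e h -> ev p h = ev q h) -> N q.
Proof. by move=> Np H; apply: (sub_eq sN) Np; apply: lc_eqW. Qed.
Lemma sub_ev0 q : (forall h, invar e h -> ev q h = 0) -> N q.
Proof. by move=> H; apply: sub_ev (sub_nil sN) _ => h ih; rewrite ev_nil H. Qed.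
Lemma sub_subl p q : N (lc_sub p q) -> N q -> N p.
Proof.
move=> Npq Nq; apply: sub_ev (sub_cat sN Npq Nq) _ => h _.
by rewrite ev_cat ev_sub subrK.
Qed.
Lemma sub_subr p q : N (lc_sub p q) -> N p -> N q.
Proof.
move=> Npq Np; apply: sub_ev (sub_sub Np Npq) _ => h _.
by rewrite !ev_sub opprB addrC subrK.
Qed.
Lemma sub_flatten Y (f : Y -> seq (k * X)) r : (forall y, N (f y)) -> N (flatten [seq f y | y <- r]).
Proof.
move=> Nf; elim: r => [|y r IH]; first exact: (sub_nil sN).
exact: (sub_cat sN).
Qed.
Lemma sub_lin_all Y (P : pred Y) (f : Y -> seq (k * X)) p :
  all (fun t => P t.2) p -> (forall y, P y -> N (f y)) -> N (lin f p).
Proof.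
move=> + Nf; elim: p => [|t p IH] /=; first by move=> _; apply: (sub_nil sN).
by case/andP=> Pt Pp; apply: (sub_cat sN); [apply/(sub_scale sN)/Nf|apply: IH].
Qed.
Lemma sub_lin Y (f : Y -> seq (k * X)) p : (forall y, N (f y)) -> N (lin f p).
Proof. by move=> Nf; apply: (@sub_lin_all _ predT) => //; apply/allT. Qed.
Lemma sub_comb (J : finType) c (v : J -> _) : (forall j, N (v j)) -> N (comb c v).
Proof.
rewrite /comb => Nv; elim: (enum J) => [|j r IH]; first exact: (sub_nil sN).
by apply: (sub_cat sN) => //; apply: (sub_scale sN).
Qed.
End Subspace.

Lemma subsp_lin X Y (e : rel X) (e' : rel Y) (f : X -> seq (k * Y)) N :
  equivalence_rel e -> equivalence_rel e' -> subsp e' N ->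
  (forall x y, e x y -> lc_eq e' (f x) (f y)) -> subsp e (fun p => N (lin f p)).
Proof.
move=> ee ee' sN fe; split.
- exact: (sub_nil sN).
- by move=> p q Np Nq; rewrite /lin map_cat flatten_cat; apply: (sub_cat sN).
- move=> c p Np; apply: (sub_ev ee' sN) (sub_scale sN c Np) _ => h ih.
  by rewrite ev_scale !ev_lin ev_scale.
- move=> p q /(lc_eqP ee) pq Np; apply: (sub_ev ee' sN) Np _ => h ih.
  rewrite !ev_lin; apply: pq => x y /fe/(lc_eqP ee'); exact.
Qed.

Lemma subsp_and X (e : rel X) N N' : subsp e N -> subsp e N' ->
  subsp e (fun p => N p /\ N' p).
Proof.
case=> [a1 a2 a3 a4] [b1 b2 b3 b4]; split=> //.
- by move=> p q [? ?] [? ?]; split; [apply: a2|apply: b2].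
- by move=> c p [? ?]; split; [apply: a3|apply: b3].
- by move=> p q pq [? ?]; split; [apply: a4 pq _|apply: b4 pq _].
Qed.
Lemma subsp_all X I' (e : rel X) (N : I' -> _) : (forall i, subsp e (N i)) ->
  subsp e (fun p => forall i, N i p).
Proof.
move=> H; split.
- by move=> i; apply: (sub_nil (H i)).
- by move=> p q Np Nq i; apply: (sub_cat (H i)).
- by move=> c p Np i; apply: (sub_scale (H i)).
- by move=> p q pq Np i; apply: (sub_eq (H i)) pq _.
Qed.

(** Independence and, below, spanning are taken in the quotient by [T]. With [T] the products of N
    with the augmentation ideal they measure the dimension of N / N S_+. *)
Definition indep (J : finType) X (T : seq (k * X) -> Prop) (v : J -> seq (k * X)) :=
  forall c, T (comb c v) -> forall j, c j = 0.
Definition inspan (J : finType) X (T : seq (k * X) -> Prop) (v : J -> seq (k * X)) p :=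
  exists c, T (lc_sub p (comb c v)).

Lemma subsp_inspan (J : finType) X (e : rel X) T (v : J -> seq (k * X)) :
  equivalence_rel e -> subsp e T -> subsp e (inspan T v).
Proof.
move=> ee sT; split.
- exists (fun=> 0); apply: (sub_ev0 ee sT) => h _.
  by rewrite ev_sub ev_nil ev_comb big1 ?subrr // => j _; rewrite mul0r.
- move=> p q [c Tc] [d Td]; exists (fun j => c j + d j).
  apply: (sub_ev ee sT) (sub_cat sT Tc Td) _ => h _.
  rewrite !(ev_cat, ev_sub, ev_comb); under [in RHS]eq_bigr do rewrite mulrDl.
  by rewrite big_split opprD addrACA.
- move=> a p [c Tc]; exists (fun j => a * c j).
  apply: (sub_ev ee sT) (sub_scale sT a Tc) _ => h _.
  rewrite !(ev_scale, ev_sub, ev_comb) mulrBr mulr_sumr.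
  by congr (_ - _); apply: eq_bigr => j _; rewrite mulrA.
- move=> p q /(lc_eqP ee) pq [c Tc]; exists c.
  by apply: (sub_ev ee sT) Tc _ => h ih; rewrite !ev_sub pq.
Qed.
Lemma inspan_sub (J : finType) X (e : rel X) T (v : J -> seq (k * X)) p :
  equivalence_rel e -> subsp e T -> T p -> inspan T v p.
Proof.
move=> ee sT Tp; exists (fun=> 0); apply: (sub_ev ee sT) Tp _ => h _.
by rewrite ev_sub ev_comb big1 ?subr0 // => j _; rewrite mul0r.
Qed.
Lemma inspan_gen (J : finType) X (e : rel X) T (v : J -> seq (k * X)) j :
  equivalence_rel e -> subsp e T -> inspan T v (v j).
Proof.
move=> ee sT; exists (fun i => (i == j)%:R); apply: (sub_ev0 ee sT) => h _.
rewrite ev_sub ev_comb (bigD1 j) //= eqxx mul1r big1 ?addr0 ?subrr // => i /negPf ->.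
by rewrite mul0r.
Qed.

(** Otherwise the coordinate matrix of [v1] with respect to [v2] has more rows than columns, and a
    nonzero vector of its left kernel is a nontrivial relation between the [v1] modulo [T]. *)
Lemma indep_le_span (J1 J2 : finType) X (e : rel X) T (v1 : J1 -> seq (k * X)) (v2 : J2 -> _) :
  equivalence_rel e -> subsp e T -> indep T v1 -> (forall j, inspan T v2 (v1 j)) ->
  (#|J1| <= #|J2|)%N.
Proof.
move=> ee sT ind /fin_all_exists[c Tc]; rewrite leqNgt; apply/negP => lt.
pose M := \matrix_(i < #|J1|, j < #|J2|) c (enum_val i) (enum_val j).
have kM : kermx M != 0.
  rewrite -mxrank_eq0 mxrank_ker subn_eq0 -ltnNge.
  exact: leq_ltn_trans (rank_leq_col _) lt.
have [i ri0] : exists i, row i (kermx M) != 0.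
  apply/existsP; apply: contraR kM; rewrite negb_exists => /forallP H.
  by apply/eqP/row_matrixP => i; rewrite row0; apply/eqP; move: (H i); rewrite negbK.
set u := row i (kermx M) in ri0.
have uM : u *m M = 0 by rewrite -row_mul mulmx_ker row0.
case/eqP: ri0; apply/rowP => j; rewrite [RHS]mxE -(enum_valK j).
apply: (ind (fun j => u 0 (enum_rank j)) _ (enum_val j)).
apply: (sub_ev ee sT) (sub_comb sT (fun j => u 0 (enum_rank j)) Tc) _ => h ih.
rewrite !ev_comb; under eq_bigr do rewrite ev_sub mulrBr.
rewrite big_split /= sumrN [X in _ - X](_ : _ = 0) ?subr0 //.
under eq_bigr do rewrite ev_comb mulr_sumr.
rewrite exchange_big big1 //= => j2 _.
under eq_bigr do rewrite mulrA.
rewrite -mulr_suml [X in X * _](_ : _ = (u *m M) 0 (enum_rank j2)).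
  by rewrite uM mxE mul0r.
rewrite mxE (reindex (@enum_val J1 xpredT)) /=; last first.
  by apply: onW_bij; apply: enum_val_bij.
by apply: eq_bigr => l _; rewrite [M _ _]mxE enum_valK enum_rankK.
Qed.

End LinearCombinations.

(** * Minimal bases of graded modules *)

Section GradedModule.
Context {k : fieldType} {X Y : Type} (eX : rel X) (act : X -> Y -> X) (dX : X -> nat)
  (dY : Y -> nat) (mY : Y -> Y -> Y) (Z : seq (k * X) -> Prop).

Definition actl (y : Y) (p : seq (k * X)) := [seq (t.1, act t.2 y) | t <- p].
Definition deg_part d (p : seq (k * X)) := [seq t <- p | dX t.2 == d].

Lemma ev_actl y p h : ev (actl y p) h = ev p (fun x => h (act x y)).
Proof. exact: ev_map. Qed.
Lemma ev_deg_part d p h : ev (deg_part d p) h = ev p (fun x => if dX x == d then h x else 0).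
Proof. exact: (ev_filter (fun x => dX x == d)). Qed.

(* X indexes the monomials of a free graded module, Y those of the ring, and Z is the
   graded submodule by which the free module is divided. *)
Record graded_module : Prop := GradedModule {
  gm_equiv : equivalence_rel eX;
  gm_act : forall x x' y, eX x x' -> eX (act x y) (act x' y);
  gm_mul : forall x y z, eX (act (act x y) z) (act x (mY y z));
  gm_one : forall x y, dY y = 0%N -> act x y = x;
  gm_deg : forall x x', eX x x' -> dX x = dX x';
  gm_deg_act : forall x y, dX (act x y) = (dX x + dY y)%N;
  gm_deg_mul : forall y z, dY (mY y z) = (dY y + dY z)%N;
  gm_sub : subsp eX Z;
  gm_null_act : forall y p, Z p -> Z (actl y p);
  gm_null_deg : forall d p, Z p -> Z (deg_part d p) }.

(** Spans are intersections of all subspaces that contain the null space and the generators. A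
    membership proof applied to a predicate is then directly an induction principle. *)
Definition lspan (W : seq (k * X) -> Prop) p :=
  forall N, subsp eX N -> (forall q, Z q -> N q) -> (forall q, W q -> N q) -> N p.
Definition gspan (W : seq (k * X) -> Prop) p :=
  forall N, subsp eX N -> (forall q, Z q -> N q) -> (forall q, W q -> N q) ->
  (forall y q, N q -> N (actl y q)) -> N p.
Definition hdeg d p := exists q, Z (lc_sub p q) /\ homog eX dX d q.
(* The product of the submodule N with the augmentation ideal of the ring. *)
Definition aug (N : seq (k * X) -> Prop) :=
  lspan (fun p => exists y q, [/\ N q, (0 < dY y)%N & p = actl y q]).

Lemma subsp_lspan W : subsp eX (lspan W).
Proof.
split.
- by move=> N sN _ _; apply: (sub_nil sN).
- by move=> p q Hp Hq N sN ZN WN; apply: (sub_cat sN); [apply: Hp|apply: Hq].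
- by move=> c p Hp N sN ZN WN; apply: (sub_scale sN); apply: Hp.
- by move=> p q pq Hp N sN ZN WN; apply: (sub_eq sN) pq _; apply: Hp.
Qed.
Lemma subsp_gspan W : subsp eX (gspan W).
Proof.
split.
- by move=> N sN _ _ _; apply: (sub_nil sN).
- by move=> p q Hp Hq N sN ZN WN aN; apply: (sub_cat sN); [apply: Hp|apply: Hq].
- by move=> c p Hp N sN ZN WN aN; apply: (sub_scale sN); apply: Hp.
- by move=> p q pq Hp N sN ZN WN aN; apply: (sub_eq sN) pq _; apply: Hp.
Qed.
Lemma lspan_null W p : Z p -> lspan W p. Proof. by move=> Zp N _ ZN _; apply: ZN. Qed.
Lemma lspan_gen (W : seq (k * X) -> Prop) p : W p -> lspan W p.
Proof. by move=> Wp N _ _ WN; apply: WN. Qed.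
Lemma aug_null N p : Z p -> aug N p. Proof. exact: lspan_null. Qed.
Lemma aug_gen N y p : (0 < dY y)%N -> N p -> aug N (actl y p).
Proof. by move=> y0 Np; apply: lspan_gen; exists y, p. Qed.
Lemma subsp_aug N : subsp eX (aug N). Proof. exact: subsp_lspan. Qed.
Lemma gspan_null W p : Z p -> gspan W p. Proof. by move=> Zp N _ ZN _ _; apply: ZN. Qed.
Lemma gspan_gen (W : seq (k * X) -> Prop) p : W p -> gspan W p.
Proof. by move=> Wp N _ _ WN _; apply: WN. Qed.
Lemma gspan_act W y p : gspan W p -> gspan W (actl y p).
Proof. by move=> Hp N sN ZN WN aN; apply: (aN); apply: Hp. Qed.

Hypothesis gm : graded_module.
Let eXe := gm_equiv gm.
Let sZ := gm_sub gm.

Lemma subsp_actl N y : subsp eX N -> subsp eX (fun p => N (actl y p)).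
Proof.
move=> sN; split.
- exact: (sub_nil sN).
- by move=> p q Np Nq; rewrite /actl map_cat; apply: (sub_cat sN).
- move=> c p Np; apply: (sub_ev eXe sN) (sub_scale sN c Np) _ => h _.
  by rewrite !(ev_scale, ev_actl).
- move=> p q /(lc_eqP eXe) pq Np; apply: (sub_ev eXe sN) Np _ => h ih.
  by rewrite !ev_actl; apply: pq => x x' /(gm_act gm y)/ih.
Qed.
Lemma subsp_deg_part N d : subsp eX N -> subsp eX (fun p => N (deg_part d p)).
Proof.
move=> sN; split.
- exact: (sub_nil sN).
- by move=> p q Np Nq; rewrite /deg_part filter_cat; apply: (sub_cat sN).
- move=> c p Np; apply: (sub_ev eXe sN) (sub_scale sN c Np) _ => h _.
  by rewrite !(ev_scale, ev_deg_part).
- move=> p q /(lc_eqP eXe) pq Np; apply: (sub_ev eXe sN) Np _ => h ih.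
  by rewrite !ev_deg_part; apply: pq => x x' xx'; rewrite (gm_deg gm xx') (ih _ _ xx').
Qed.

Lemma null_of_lc_eq p q : lc_eq eX p q -> Z (lc_sub p q).
Proof.
by move/(lc_eqP eXe) => pq; apply: (sub_ev0 eXe sZ) => h /pq e; rewrite ev_sub e subrr.
Qed.
Lemma homog_deg_part d q : homog eX dX d q -> lc_eq eX q (deg_part d q).
Proof.
move=> hq m; rewrite !coef_ev ev_deg_part.
have [<-|dm] := eqVneq (dX m) d.
  apply: eq_ev => x; case: eqP => // xm; case: (boolP (eX x m)) => // /(gm_deg gm).
  by move/xm.
transitivity (0 : k); last first.
  apply/esym/ev_zero => x; case: eqP => // xd.
  case: (boolP (eX x m)) => // /(gm_deg gm) xm; case/eqP: dm; by rewrite -xm.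
by rewrite -coef_ev; apply: contraNeq dm => /hq ->.
Qed.
(** Homogeneity means having some homogeneous representative. Since the null space is graded, the
    degree part of the given list can serve as that representative. *)
Lemma hdeg_deg_part d p : hdeg d p -> Z (lc_sub p (deg_part d p)).
Proof.
case=> q [Zpq /homog_deg_part/null_of_lc_eq Zq].
have Zd := gm_null_deg gm d Zpq.
apply: (sub_ev eXe sZ (sub_cat sZ Zpq (sub_sub sZ Zq Zd))) => h _.
rewrite ev_cat !ev_sub !ev_deg_part ev_sub.
by rewrite opprB !addrA !subrK.
Qed.
Lemma hdeg_deg_part0 d e p : hdeg d p -> d != e -> Z (deg_part e p).
Proof.
move=> /hdeg_deg_part/(gm_null_deg gm e) H de.
apply: (sub_ev eXe sZ) H _ => h _.
rewrite !ev_deg_part ev_sub ev_deg_part [X in _ - X]ev_zero ?subr0 // => x.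
by case: eqP => // ->; case: eqP => // ed; rewrite ed eqxx in de.
Qed.
Lemma hdeg_unique d e p : hdeg d p -> hdeg e p -> d != e -> Z p.
Proof.
move=> hd he de; apply: (sub_subl eXe sZ (hdeg_deg_part he)).
exact: hdeg_deg_part0 hd de.
Qed.
Lemma deg_part_hdeg d p : hdeg d (deg_part d p).
Proof.
exists (deg_part d p); split; first by apply: null_of_lc_eq.
move=> m; rewrite coef_ev ev_deg_part => H; apply/eqP; apply: contraNT H => dm.
apply/eqP/ev_zero => x; case: eqP => // xd.
by case: (boolP (eX x m)) => // /(gm_deg gm) xm; rewrite -xm xd eqxx in dm.
Qed.
Lemma hdeg_null d p q : Z (lc_sub p q) -> hdeg d q -> hdeg d p.
Proof.
move=> Zpq [r [Zqr hr]]; exists r; split=> //.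
apply: (sub_ev eXe sZ) (sub_cat sZ Zpq Zqr) _ => h _.
by rewrite ev_cat !ev_sub addrA subrK.
Qed.
Lemma hdeg_all d p : all (fun t => dX t.2 == d) p -> hdeg d p.
Proof. by move/all_filterP=> <-; apply: deg_part_hdeg. Qed.
Lemma all_deg_part d p : all (fun t => dX t.2 == d) (deg_part d p).
Proof. exact: filter_all. Qed.
Lemma hdeg_actl d y p : hdeg d p -> hdeg (d + dY y) (actl y p).
Proof.
move=> hd; apply: (@hdeg_null _ _ (actl y (deg_part d p))).
  apply: (sub_ev eXe sZ) (gm_null_act gm y (hdeg_deg_part hd)) _ => h _.
  by rewrite ev_actl !ev_sub !ev_actl.
apply: hdeg_all; rewrite all_map; apply: sub_all (all_deg_part d p) => t /= /eqP <-.
by rewrite (gm_deg_act gm).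
Qed.
Lemma actl_deg0 y p : dY y = 0%N -> actl y p = p.
Proof.
by move=> y0; elim: p => //= t p ->; rewrite (gm_one gm) //; case: t.
Qed.
Lemma deg_part_sum p : exists M, forall h,
  \sum_(d < M) ev (deg_part d p) h = ev p h.
Proof.
have [M HM] : exists M, all (fun t => dX t.2 < M)%N p.
  exists (\max_(t <- p) dX t.2).+1.
  elim: p => //= t p IH; rewrite big_cons ltnS leq_maxl /=.
  by apply: sub_all IH => u; rewrite !ltnS leq_max orbC => ->.
exists M => h; under eq_bigr do rewrite ev_deg_part.
rewrite -ev_sum; apply: (@eq_ev_all _ _ (fun x => dX x < M)%N) => //.
move=> x lx; rewrite (bigD1 (Ordinal lx)) //= eqxx big1 ?addr0 // => j jx.
by case: eqP => // E; case/eqP: jx; apply: val_inj.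
Qed.
Lemma sub_deg_parts N p : subsp eX N -> (forall d, N (deg_part d p)) -> N p.
Proof.
move=> sN Nd; have [M HM] := deg_part_sum p.
apply: (sub_ev eXe sN) (sub_flatten sN (index_enum 'I_M) Nd) _ => h _.
by rewrite ev_flatten big_map HM.
Qed.

(** The predicate [N] is only a subspace and need not be stable under the action. Carrying all the
    translates along in the induction reduces membership in a submodule to the monomial multiples of
    its generators. *)
Lemma gspan_ind_act (W N : seq (k * X) -> Prop) p : subsp eX N -> (forall q, Z q -> N q) ->
  (forall q, W q -> N q) -> (forall y q, W q -> N (actl y q)) -> gspan W p -> N p.
Proof.
move=> sN ZN WN aN Hp.
suff [] : N p /\ forall y, N (actl y p) by [].
apply: (Hp (fun p => N p /\ forall y, N (actl y p))).
- apply: subsp_and => //; apply: subsp_all => y; exact: subsp_actl.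
- by move=> q Zq; split=> [|y]; apply: ZN => //; apply: (gm_null_act gm).
- by move=> q Wq; split=> [|y]; [apply: WN|apply: aN].
- move=> y q [_ Hq]; split=> // z; apply: (sub_ev eXe sN) (Hq (mY y z)) _ => h ih.
  by rewrite !ev_actl; apply: eq_ev => x; apply/esym/ih/(gm_mul gm).
Qed.

Lemma gspan_sub (W W' : seq (k * X) -> Prop) p :
  (forall q, W q -> gspan W' q) -> gspan W p -> gspan W' p.
Proof.
move=> WW' Hp; apply: (Hp (gspan W')); first exact: subsp_gspan.
- by move=> q; apply: gspan_null.
- exact: WW'.
- exact: gspan_act.
Qed.

Section Nakayama.
Variables (B : seq (k * X) -> Prop).
Hypothesis homB : forall b, B b -> exists d, hdeg d b.

(** This is Nakayama's argument in one degree: a multiple of a generator by a monomial of positive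
    degree is in the augmentation part, and monomials of degree zero act trivially, so only the
    generators of degree [d] remain. *)
Lemma gspan_aug d (N : seq (k * X) -> Prop) p : subsp eX N ->
  (forall q, aug (gspan B) q -> N q) -> (forall b, B b -> hdeg d b -> N b) ->
  gspan B p -> hdeg d p -> N p.
Proof.
move=> sN TN BN Bp hp.
have ZN q : Z q -> N q by move=> Zq; apply: TN; apply: aug_null.
apply: (sub_subl eXe sN (q := deg_part d p)); first exact/ZN/hdeg_deg_part.
have key y b : B b -> N (deg_part d (actl y b)).
  move=> Bb; have [e hb] := homB Bb.
  have hby := hdeg_actl y hb.
  have [E|ne] := eqVneq (e + dY y)%N d; last by exact/ZN/(hdeg_deg_part0 hby).
  apply: (sub_subr eXe sN (p := actl y b)); first by rewrite -E; apply/ZN/hdeg_deg_part.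
  have [y0|y0] := posnP (dY y).
    by rewrite actl_deg0 //; apply: BN; rewrite // -E y0 addn0.
  by apply: TN; apply: aug_gen => //; apply: gspan_gen.
apply: (gspan_ind_act (W := B) (N := fun q => N (deg_part d q))) Bp => [|q Zq|b Bb|]; first exact: subsp_deg_part.
- exact/ZN/(gm_null_deg gm).
- have [e hb] := homB Bb; have [E|ne] := eqVneq e d; last by exact/ZN/(hdeg_deg_part0 hb).
  rewrite E in hb; apply: (sub_subr eXe sN (p := b)); first exact/ZN/hdeg_deg_part.
  exact: BN.
- exact: key.
Qed.

Lemma gspan_deg_part d p : gspan B p -> gspan B (deg_part d p).
Proof.
have sB := subsp_gspan B.
apply: (gspan_ind_act (W := B) (N := fun q => gspan B (deg_part d q))) => [|q Zq|b Bb|y b Bb]; first exact: subsp_deg_part.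
- apply: gspan_null; exact: (gm_null_deg gm).
- have [e hb] := homB Bb; have [E|ne] := eqVneq e d; last by apply: gspan_null; apply: (hdeg_deg_part0 hb).
  rewrite E in hb; apply: (sub_subr eXe sB (p := b)); first by apply: gspan_null; apply: hdeg_deg_part.
  exact: gspan_gen.
- have [e /(hdeg_actl y) hb] := homB Bb.
  have [E|ne] := eqVneq (e + dY y)%N d; last by apply: gspan_null; apply: (hdeg_deg_part0 hb).
  rewrite E in hb; apply: (sub_subr eXe sB (p := actl y b)); first by apply: gspan_null; apply: hdeg_deg_part.
  by apply: gspan_act; apply: gspan_gen.
Qed.

End Nakayama.

End GradedModule.
Arguments gspan {k X Y} eX act Z W p.
Arguments aug {k X Y} eX act dY Z N p.
Arguments hdeg {k X} eX dX Z d p.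

Section MinimalBases.
Context {k : fieldType} {X : eqType} {Y : Type} (eX : rel X) (act : X -> Y -> X) (dX : X -> nat)
  (dY : Y -> nat) (mY : Y -> Y -> Y) (Z : seq (k * X) -> Prop).
Hypothesis gm : graded_module eX act dX dY mY Z.
Let eXe := gm_equiv gm.
Let sZ := gm_sub gm.
Let gsp := gspan eX act Z.
Let hd := hdeg eX dX Z.
Variables (N B : seq (k * X) -> Prop).
Hypothesis minB : min_hbasis gsp hd N B.
Let T := aug eX act dY Z N.

(** In degree [d], the products with the augmentation ideal involve only basis elements of degree
    below [d], hence not [v j]. A relation with [c j] nonzero would therefore express [v j] by the
    other basis elements. *)
Lemma min_hbasis_indep d (J : finType) (v : J -> seq (k * X)) : injective v ->
  (forall j, B (v j)) -> (forall j, hd d (v j)) -> indep T v.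
Proof.
move=> vinj Bv hv c Tc j; have [NB homB minb] := minB.
apply: NNPP => /eqP cj; apply: (minb _ (Bv j)).
set B' := fun b => _ in minb *; have sB' := subsp_gspan eX act Z B'.
have homB' b : B' b -> exists d, hd d b by case=> /homB.
(* An element homogeneous of two degrees is null, and a null element lies in every span, against
   minimality. So a basis element of another degree differs from [v j]. *)
have nZ b' e : B b' -> hd e b' -> e != d -> B' b'.
  move=> Bb hb ed; split=> // E; rewrite E in hb.
  apply: (minb _ (Bv j)); apply: gspan_null.
  exact: (hdeg_unique gm hb (hv j) ed).
have key : gsp B' (deg_part dX d (comb c v)).
  apply: (Tc (fun q => gsp B' (deg_part dX d q))) => [|q Zq|_ [y [q [/NB Nq y0 ->]]]]; first exact: (subsp_deg_part gm).
    apply: gspan_null; exact: (gm_null_deg gm).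
  have main z b : B b -> (0 < dY z)%N -> gsp B' (deg_part dX d (actl act z b)).
    move=> Bb z0; have [e hb] := homB _ Bb; have hbz := hdeg_actl gm z hb.
    have [E|ne] := eqVneq (e + dY z)%N d; last by apply: gspan_null; apply: (hdeg_deg_part0 gm hbz).
    apply: (sub_subr eXe sB' (p := actl act z b)).
      by rewrite -E; apply: gspan_null; apply: (hdeg_deg_part gm).
    apply: gspan_act; apply: gspan_gen; apply: (nZ _ e) => //.
    by rewrite -E -[X in X != _]addn0 eqn_add2l eq_sym -lt0n.
  apply: (gspan_ind_act gm (W := B) (N := fun q => gsp B' (deg_part dX d (actl act y q)))) Nq.
  - by apply: (subsp_actl gm y (N := fun q => gsp B' (deg_part dX d q))); apply: (subsp_deg_part gm).
  - by move=> r Zr; apply: gspan_null; apply: (gm_null_deg gm); apply: (gm_null_act gm).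
  - by move=> b Bb; apply: main.
  - move=> z b Bb; apply: (sub_ev eXe sB') (main (mY z y) b Bb _) _; last first.
      move=> h ih; rewrite !ev_deg_part !ev_actl; apply: eq_ev => x.
      have E := gm_mul gm x z y; by rewrite (gm_deg gm E) (ih _ _ E).
    by rewrite (gm_deg_mul gm) ltn_addl.
have {}key : gsp B' (comb c v).
  apply: (sub_subl eXe sB') key.
  apply: gspan_null; apply: (sub_ev eXe sZ) (sub_comb sZ c (fun j => hdeg_deg_part gm (hv j))) _ => h ih.
  rewrite ev_sub ev_deg_part !ev_comb -sumrB; apply: eq_bigr => i _.
  by rewrite ev_sub ev_deg_part mulrBr.
(* Subtracting this family, which omits [v j], isolates the term [c j] times [v j]. *)
pose w i := if i == j then [::] else v i.
have sw : gsp B' (comb c w).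
  apply: (sub_comb sB') => i; rewrite /w; case: eqP => [_|ij]; first exact: (sub_nil sB').
  by apply: gspan_gen; split=> // /vinj.
apply: (sub_ev eXe sB') (sub_scale sB' (c j)^-1 (sub_sub sB' key sw)) _ => h ih.
rewrite ev_scale ev_sub !ev_comb (bigD1 j) //= (bigD1 j (P := predT) (F := fun i => c i * ev (w i) h)) //=.
have wj : w j = [::] by rewrite /w eqxx.
rewrite wj ev_nil mulr0 add0r -addrA -sumrB big1 ?addr0 ?mulKf // => i /negPf ij.
by rewrite /w ij subrr.
Qed.

(** A basis is a mere predicate, so finiteness in each degree must be proved: distinct elements of
    degree [d] are independent modulo [T], hence also modulo the smaller [T'], and there are at most
    [#|J|] of them. *)
Lemma min_hbasis_finite d (J : finType) (w : J -> seq (k * X)) (T' : seq (k * X) -> Prop) :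
  subsp eX T' -> (forall p, T' p -> T p) ->
  (forall b, B b -> hd d b -> inspan T' w b) ->
  exists l : seq (seq (k * X)), [/\ uniq l, forall x, x \in l <-> (B x /\ hd d x)
     & (size l <= #|J|)%N].
Proof.
move=> sT' T'T Hw.
have bnd l : uniq l -> (forall x, x \in l -> B x /\ hd d x) -> (size l <= #|J|)%N.
  move=> ul lB; rewrite -[size l]card_ord.
  pose v (i : 'I_(size l)) := tnth (in_tuple l) i.
  have vl i : v i \in l by rewrite /v mem_tnth.
  apply: (indep_le_span (T := T') (v1 := v) (v2 := w) eXe sT') => [|i]; last first.
    by have [? ?] := lB _ (vl i); apply: Hw.
  move=> c /T'T; apply: (min_hbasis_indep (d := d)) => [i i'|i|i].
  - rewrite /v !(tnth_nth [::]) => /eqP; rewrite nth_uniq //= => /eqP; exact: val_inj.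
  - by have [] := lB _ (vl i).
  - by have [] := lB _ (vl i).
(* By excluded middle, a list is either exhaustive or can be extended by one element. A list of
   length [#|J|.+1] contradicts the bound. *)
suff: forall m, (m <= #|J|.+1)%N -> 
    (exists l : seq (seq (k * X)), [/\ uniq l, forall x, x \in l <-> (B x /\ hd d x)
     & (size l <= #|J|)%N]) \/ exists l : seq (seq (k * X)), [/\ uniq l, size l = m & forall x, x \in l -> B x /\ hd d x].
  case/(_ _ (leqnn _)) => // -[l [ul sl lB]]; have := bnd _ ul lB.
  by rewrite sl ltnn.
elim=> [|m IH] lm; first by right; exists [::].
case: (IH (ltnW lm)) => [|[l [ul sl lB]]]; first by left.
case: (classic (exists x, [/\ x \notin l, B x & hd d x])) => [[x [xl Bx hx]]|H].
  right; exists (x :: l); split; rewrite /= ?xl ?sl // => y.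
  by rewrite inE => /orP[/eqP ->|/lB].
left; exists l; split=> //; last exact: bnd.
move=> x; split; first exact: lB.
by case=> Bx hx; apply: NNPP => /negP xl; apply: H; exists x.
Qed.

End MinimalBases.

(** * The letterplace ideal *)

Section Columns.
Context {n : nat}.
Implicit Types (u v : cmon n) (w : word n) (a b m s d j : nat).

Definition col j u : word n := [seq x.1 | x <- u & x.2 == j].
Definition colword a d u : word n := flatten [seq col j u | j <- iota a d].
(* Among the columns below m, exactly those in [a, m) occur in u, each once. *)
Definition exact_cols a m u := all (fun j => size (col j u) == (a <= j)%N :> nat) (iota 0 m).
Definition tailmon m u : cmon n := [seq x <- u | m <= x.2]%N.

Lemma col_cat j u v : col j (u ++ v) = col j u ++ col j v.
Proof. by rewrite /col filter_cat map_cat. Qed.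
Lemma tailmon_cat m u v : tailmon m (u ++ v) = tailmon m u ++ tailmon m v.
Proof. exact: filter_cat. Qed.
Lemma perm_col j u v : perm_eq u v -> perm_eq (col j u) (col j v).
Proof. by move=> uv; apply/perm_map/perm_filter. Qed.
Lemma perm_tailmon m u v : perm_eq u v -> perm_eq (tailmon m u) (tailmon m v).
Proof. exact: perm_filter. Qed.
Lemma perm_col_nil j u v : perm_eq u v -> (col j u == [::]) = (col j v == [::]).
Proof. by move/(perm_col j)/perm_size; rewrite -!size_eq0 => ->. Qed.
Lemma perm_exact_cols a m u v : perm_eq u v -> exact_cols a m u = exact_cols a m v.
Proof. by move=> uv; apply: eq_all => j; rewrite (perm_size (perm_col j uv)). Qed.
(** With at most one letter in each column, the order of reading is dictated by the columns. A
    repeated column would make the word depend on the order of the list. *)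
Lemma perm_colword a m u v : exact_cols a m u -> perm_eq u v -> colword 0 m u = colword 0 m v.
Proof.
move=> /allP eu uv; congr flatten; apply/eq_in_map => j jm.
apply: perm_small_eq (perm_col j uv).
by rewrite -(perm_size (perm_col j uv)) (eqP (eu j jm)) leq_b1.
Qed.

Lemma lpmon_cons s i w : lpmon s (i :: w) = (i, s) :: lpmon s.+1 w.
Proof.
rewrite /lpmon /=; congr (_ :: _); rewrite (iotaDl 1 0).
elim: w (iota 0 _) => [|l w IH] [|j r] //=; rewrite IH.
by congr ((_, _) :: _); lia.
Qed.
Lemma lpmon_cat s (v w : word n) : lpmon s (v ++ w) = lpmon s v ++ lpmon (s + size v) w.
Proof.
elim: v s => [|i v IH] s; first by rewrite addn0.
by rewrite cat_cons !lpmon_cons IH /= addSnnS.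
Qed.
Lemma map_snd_lpmon s w : [seq x.2 | x <- lpmon s w] = iota s (size w).
Proof. by elim: w s => // i w IH s; rewrite lpmon_cons /= IH. Qed.
Lemma size_lpmon s w : size (lpmon s w) = size w.
Proof. by rewrite -[LHS](size_map (fun x => x.2)) map_snd_lpmon size_iota. Qed.
Lemma size_colE j u : size (col j u) = count_mem j [seq x.2 | x <- u].
Proof. by rewrite size_map size_filter count_map. Qed.
Lemma size_col_lpmon j s w : size (col j (lpmon s w)) = (s <= j < s + size w)%N.
Proof. by rewrite size_colE map_snd_lpmon count_uniq_mem ?iota_uniq // mem_iota. Qed.
Lemma col_lpmon_nil j s w : ~~ (s <= j < s + size w)%N -> col j (lpmon s w) = [::].
Proof. by move/negPf => H; apply/size0nil; rewrite size_col_lpmon H. Qed.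
Lemma colword_lpmon s w : colword s (size w) (lpmon s w) = w.
Proof.
elim: w s => // i w IH s; rewrite /colword /= lpmon_cons.
rewrite {1}/col /= eqxx /= -/(col s _) col_lpmon_nil ?ltnn //=; congr (_ :: _).
rewrite -[RHS](IH s.+1); congr flatten; apply/eq_in_map => j.
by rewrite mem_iota /col /= => /andP[sj _]; rewrite ltn_eqF.
Qed.
Lemma colword_eq a d u v : (forall j, (a <= j < a + d)%N -> col j u = col j v) ->
  colword a d u = colword a d v.
Proof. by move=> H; congr flatten; apply/eq_in_map => j; rewrite mem_iota => /H. Qed.
Lemma colword_nil a d u : (forall j, (a <= j < a + d)%N -> col j u = [::]) ->
  colword a d u = [::].
Proof. by move=> /(@colword_eq _ _ _ [::]) ->; rewrite /colword; elim: (iota _ _). Qed.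
Lemma colword_add a d e u : colword a (d + e) u = colword a d u ++ colword (a + d) e u.
Proof. by rewrite /colword iotaD map_cat flatten_cat. Qed.
Lemma exact_colsP a m u : reflect (forall j, (j < m)%N -> size (col j u) = (a <= j)%N)
  (exact_cols a m u).
Proof.
apply: (iffP allP) => H j; first by move=> jm; apply/eqP/H; rewrite mem_iota.
by rewrite mem_iota add0n => /andP[_ jm]; rewrite H.
Qed.

(** Exactness leaves no room for letters of [u] in the columns of the run, so [w] appears as a
    factor. This is where the two-sidedness of the ideal can be applied later. *)
Lemma colword_lpmon_mid a m s w u : (s + size w <= m)%N -> exact_cols a m (lpmon s w ++ u) ->
  colword 0 m (lpmon s w ++ u) =
  colword 0 s u ++ w ++ colword (s + size w) (m - (s + size w)) u.
Proof.
move=> le /exact_colsP ex; rewrite -{1}(subnKC le) !colword_add add0n -catA.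
congr (_ ++ (_ ++ _)).
- apply: colword_eq => j jj; rewrite col_cat col_lpmon_nil //; lia.
- rewrite -[RHS](colword_lpmon s w); apply: colword_eq => j jj.
  rewrite col_cat (size0nil (s := col j u)) ?cats0 //.
  have := ex j; rewrite col_cat size_cat size_col_lpmon jj.
  by case: (a <= j)%N; lia.
- apply: colword_eq => j jj; rewrite col_cat col_lpmon_nil //; lia.
Qed.
Lemma exact_cols_dup a m i l j u : (j < m)%N -> exact_cols a m ([:: (i, j); (l, j)] ++ u) = false.
Proof.
move=> jm; apply/exact_colsP => /(_ j jm).
by rewrite col_cat size_cat /col /= eqxx /=; case: (a <= j)%N.
Qed.
Lemma tailmon_lpmon_lo m s w : (s + size w <= m)%N -> tailmon m (lpmon s w) = [::].
Proof.
elim: w s => // i w IH s; rewrite lpmon_cons /= => le; rewrite IH; last lia.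
by case: leqP => //; lia.
Qed.
Lemma tailmon_lpmon_hi m s w : (m <= s)%N -> tailmon m (lpmon s w) = lpmon s w.
Proof. by elim: w s => // i w IH s le; rewrite lpmon_cons /= le IH //; lia. Qed.

End Columns.

Section Equivalences.
Context {n : nat}.
Lemma ceq_equiv : equivalence_rel (@ceq n).
Proof.
move=> x y z; split; first exact: perm_refl.
by move=> xy; rewrite /ceq (permPl xy).
Qed.
Lemma eq_equiv (T : eqType) : equivalence_rel (fun a b : T => a == b).
Proof. by move=> x y z; split=> [|/eqP ->]. Qed.
Lemma feq_equiv (Ix : eqType) : equivalence_rel (@feq n Ix).
Proof. exact: eq_equiv. Qed.
Lemma meq_equiv (Ix : eqType) : equivalence_rel (@meq n Ix).
Proof.
move=> x y z; split; first by rewrite /meq eqxx perm_refl.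
by case/andP=> /eqP e xy; rewrite /meq e (permPl xy).
Qed.
End Equivalences.

Section LetterplaceIdeal.
Context {k : fieldType} {n : nat} (I : seq (k * word n) -> Prop).
Hypothesis HI : is_graded_ideal I.
Let weqe : equivalence_rel (@weq n) := @eq_equiv _.
Let ceqe : equivalence_rel (@ceq n) := ceq_equiv.

Lemma subsp_I : subsp (@weq n) I.
Proof. by case: HI => -[H1 H2] H3 H4 _ _; split=> // p q; apply: H1. Qed.
Let sI := subsp_I.
Lemma I_mull v p : I p -> I [seq (t.1, v ++ t.2) | t <- p].
Proof.
case: HI => _ _ _ H _ /(H [:: (1, v)])[Ip _]; apply: (sub_ev weqe sI) Ip _ => h _.
by rewrite ev_lc_mul ev1 mul1r ev_map.
Qed.
Lemma I_mulr v p : I p -> I (actl cat v p).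
Proof.
case: HI => _ _ _ H _ /(H [:: (1, v)])[_ Ip]; apply: (sub_ev weqe sI) Ip _ => h _.
by rewrite ev_lc_mul ev_actl; apply: eq_ev => x; rewrite ev1 mul1r.
Qed.
Lemma I_deg d p : I p -> I (deg_part size d p).
Proof. by case: HI => _ _ _ _; apply. Qed.

Lemma subsp_SI : subsp (@ceq n) (SI I).
Proof.
split; [exact: ig_zero|exact: ig_add| |by move=> p q H Hp; apply: ig_equiv Hp H].
move=> c p /(ig_mul [:: (c, [::])]) Hp; apply: ig_equiv Hp _; apply: lc_eqW => // h _.
by rewrite ev_lc_mul ev1 ev_scale.
Qed.
Let sS := subsp_SI.

Lemma SI_mul v p : SI I p -> SI I (actl cat v p).
Proof.
move/(ig_mul [:: (1, v)]) => Hp; apply: ig_equiv Hp _; apply: lc_eqW => // h ih.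
rewrite ev_lc_mul ev1 mul1r ev_actl; apply: eq_ev => x; apply: ih.
by rewrite /ceq perm_catC.
Qed.
Lemma SI_dup i l j v : SI I [:: (1, [:: (i, j); (l, j)] ++ v)].
Proof.
apply: (sub_ev ceqe sS) (SI_mul v (p := [:: (1, [:: (i, j); (l, j)])]) _) _ => //.
by apply: ig_gen; left; exists i, l, j.
Qed.
Lemma SI_iota s f : I f -> SI I (iotaP s f).
Proof. by move=> If; apply: ig_gen; right; exists f, s. Qed.
Lemma ev_iotaP s (f : seq (k * word n)) h : ev (iotaP s f) h = ev f (fun w => h (lpmon s w)).
Proof. exact: ev_map. Qed.

Lemma subsp_cat_actl D v : subsp (@ceq n) D -> subsp (@ceq n) (fun p : seq (k * _) => D (actl cat v p)).
Proof.
move=> sD; split.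
- exact: (sub_nil sD).
- by move=> p q Np Nq; rewrite /actl map_cat; apply: (sub_cat sD).
- move=> c p Np; apply: (sub_ev ceqe sD) (sub_scale sD c Np) _ => h _.
  by rewrite !(ev_scale, ev_actl).
- move=> p q /(lc_eqP ceqe) pq Np; apply: (sub_ev ceqe sD) Np _ => h ih.
  by rewrite !ev_actl; apply: pq => x x' xx'; apply: ih; rewrite /ceq perm_cat2r.
Qed.

(** The ideal is spanned by monomial multiples of its generators, and [f] may be split into
    homogeneous parts. All terms of such a multiple then occupy the same columns, so a test on
    columns keeps either all of them or none. *)
Lemma SI_ind (D : seq (k * cmon n) -> Prop) : subsp (@ceq n) D ->
  (forall i l j v, D [:: (1, [:: (i, j); (l, j)] ++ v)]) ->
  (forall f d s v, I f -> all (fun t => size t.2 == d) f -> D (actl cat v (iotaP s f))) ->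
  forall p, SI I p -> D p.
Proof.
move=> sD Dq Df p Hp.
suff H : forall v, D (actl cat v p).
  by apply: (sub_ev ceqe sD) (H [::]) _ => h _; rewrite ev_actl; apply: eq_ev => x; rewrite cats0.
elim: {p}Hp => [p [[i [l [j ->]]]|[f [s [If ->]]]]|  |p q _ Hp _ Hq|f p _ Hp|p q _ Hp pq] v.
- exact: Dq.
- have [M HM] := deg_part_sum size f.
  apply: (sub_ev ceqe sD) (sub_flatten sD (f := fun d : 'I_M => actl cat v (iotaP s (deg_part size d f))) (index_enum 'I_M) _) _.
    by move=> d; apply: (Df _ d); [apply: I_deg|apply: all_deg_part].
  move=> h _; rewrite ev_flatten big_map ev_actl ev_iotaP -HM.
  by apply: eq_bigr => d _; rewrite ev_actl ev_iotaP.
- exact: (sub_nil sD).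
- by rewrite /actl map_cat; apply: (sub_cat sD); [apply: Hp|apply: Hq].
- apply: (sub_ev ceqe sD) (sub_lin sD (f := fun x => actl cat (x ++ v) p) f _) _.
    by move=> x; apply: Hp.
  move=> h ih; rewrite ev_lin ev_actl ev_lc_mul; apply: eq_ev => x.
  rewrite ev_actl; apply: eq_ev => y; apply: ih.
  by rewrite /ceq catA perm_cat2r perm_catC.
- exact: (sub_eq (subsp_cat_actl v sD) pq).
Qed.

(** Both kinds of generators are homogeneous for the grading by multisets of columns, so selecting
    monomials by their columns preserves the ideal. The degree grading of S and the low part are
    instances. *)
Lemma SI_filter (chi : pred (seq nat)) : (forall x y, perm_eq x y -> chi x = chi y) ->
  forall p, SI I p -> SI I [seq t <- p | chi [seq x.2 | x <- t.2]].
Proof.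
move=> chiP; pose P (u : cmon n) := chi [seq x.2 | x <- u].
have PP u v : ceq u v -> P u = P v by move=> uv; apply: chiP; apply: perm_map.
apply: (SI_ind (D := fun p => SI I [seq t <- p | P t.2])).
- split.
  + exact: (sub_nil sS).
  + by move=> p q Np Nq; rewrite filter_cat; apply: (sub_cat sS).
  + move=> c p Np; apply: (sub_ev ceqe sS) (sub_scale sS c Np) _ => h _.
    by rewrite !(ev_scale, ev_filter).
  + move=> p q /(lc_eqP ceqe) pq Np; apply: (sub_ev ceqe sS) Np _ => h ih.
    by rewrite !ev_filter; apply: pq => x x' xx'; rewrite (PP _ _ xx') (ih _ _ xx').
- by move=> i l j v /=; case: ifP => _; [apply: SI_dup|apply: (sub_nil sS)].
- move=> f d s v If fd; pose b := chi (iota s d ++ [seq x.2 | x <- v]).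
  have E : [seq t <- actl cat v (iotaP s f) | P t.2] = if b then actl cat v (iotaP s f) else [::].
    have bE t : t \in actl cat v (iotaP s f) -> P t.2 = b.
      case/mapP=> _ /mapP[t' tf ->] ->; rewrite /P map_cat map_snd_lpmon.
      by rewrite (eqP (allP fd _ tf)).
    rewrite (eq_in_filter bE); case: b {bE}; [exact: filter_predT|exact: filter_pred0].
  rewrite E; case: b {E}; last exact: (sub_nil sS).
  exact/SI_mul/SI_iota.
Qed.

(** * Functionals on words as endomorphisms of S *)

Section HeadFunctional.
Variables (m : nat) (lam : word n -> k).
Hypothesis lam0 : forall f, I f -> ev f lam = 0.

(** Column [m] is required to be empty, so the tail that is kept lies strictly beyond [m] and is
    separated from the head. *)
Definition head_lam (u : cmon n) : seq (k * cmon n) :=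
  if exact_cols 0 m u && (col m u == [::]) then [:: (lam (colword 0 m u), tailmon m u)] else [::].

Lemma head_lam_perm u v : ceq u v -> lc_eq (@ceq n) (head_lam u) (head_lam v).
Proof.
move=> uv; apply: lc_eqW => // h ih; rewrite /head_lam -(perm_exact_cols 0 m uv) -(perm_col_nil m uv).
case: ifP => // /andP[ex _]; rewrite !ev1 (perm_colword ex uv).
by rewrite (ih _ _ (perm_tailmon m uv)).
Qed.

(* Q kills a repeated column, and no run produced by a generator sigma^s(iota f) can cross the
   missing column m: it lies either in the head, where lam kills it, or in the tail. *)
Lemma SI_head_lam p : SI I p -> SI I (lin head_lam p).
Proof.
apply: (SI_ind (D := fun p => SI I (lin head_lam p))).
- by apply: subsp_lin ceqe ceqe sS _ => u v; apply: head_lam_perm.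
- move=> i l j v; rewrite /lin /= cats0 /head_lam.
  case: ifP => [/andP[ex cm]|_]; last exact: (sub_nil sS).
  apply: (sub_scale sS); have [jm|mj] := ltnP j m; first by rewrite exact_cols_dup in ex.
  apply: (sub_ev ceqe sS) (sub_scale sS (lam (colword 0 m ([:: (i, j); (l, j)] ++ v))) (SI_dup i l j (tailmon m v))) _ => h _.
  by rewrite ev_scale !ev1 mul1r /tailmon /= mj.
- move=> f d s v If fd.
  have sz w : size w == d -> forall j, size (col j (lpmon s w ++ v)) =
      ((s <= j < s + d)%N + size (col j v))%N.
    by move=> /eqP wd j; rewrite col_cat size_cat size_col_lpmon wd.
  pose u0 (w : word n) := lpmon s w ++ v.
  (* The test of [head_lam] sees only columns, so it has one value for all the words of [f], whose
     length is [d]. *)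
  pose b := all (fun j => ((s <= j < s + d)%N + size (col j v) == (0 <= j)%N :> nat)%N) (iota 0 m)
     && ((s <= m < s + d)%N + size (col m v) == 0)%N.
  have bE w : size w == d -> exact_cols 0 m (u0 w) && (col m (u0 w) == [::]) = b.
    move=> wd; rewrite -size_eq0 sz //; congr (_ && _).
    by apply: eq_all => j; rewrite sz.
  have evL h : ev (lin head_lam (actl cat v (iotaP s f))) h =
     if b then ev f (fun w => lam (colword 0 m (u0 w)) * h (tailmon m (u0 w))) else 0.
    rewrite ev_lin ev_actl ev_iotaP.
    transitivity (ev f (fun w => if b then lam (colword 0 m (u0 w)) * h (tailmon m (u0 w)) else 0)); last exact: ev_if.
    apply: (eq_ev_all (P := fun w : word n => size w == d) fd) => w wd; rewrite /head_lam bE //.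
    by case: (b); rewrite ?ev1.
  case: (boolP b) => [bt|bf]; last by apply: (sub_ev0 ceqe sS) => h _; rewrite evL (negPf bf).
  have [le|gt] := leqP (s + d) m.
    apply: (sub_ev0 ceqe sS) => h _; rewrite evL bt.
    transitivity (ev f (fun w => lam (colword 0 s v ++ w ++ colword (s + d) (m - (s + d)) v) * h (tailmon m v))).
      apply: (eq_ev_all (P := fun w : word n => size w == d) fd) => w wd; have ex := bE w wd; rewrite bt in ex; case/andP: ex => ex _.
      rewrite (colword_lpmon_mid _ ex) (eqP wd) // tailmon_cat tailmon_lpmon_lo //.
      by rewrite (eqP wd).
    rewrite ev_mulr; have /lam0 := I_mull (colword 0 s v) (I_mulr (colword (s + d) (m - (s + d)) v) If).
    by rewrite ev_map ev_actl => ->; rewrite mul0r.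
  have lt : (m < s)%N by move: bt; rewrite /b gt andbT; case: leqP => //; rewrite andbF.
  apply: (sub_ev ceqe sS) (sub_scale sS (lam (colword 0 m v)) (SI_mul (tailmon m v) (SI_iota s If))) _ => h _.
  rewrite evL bt ev_scale ev_actl ev_iotaP -ev_mull; apply: eq_ev => w; congr (lam _ * h _).
    by apply: colword_eq => j jj; rewrite /u0 col_cat col_lpmon_nil //; lia.
  by rewrite /u0 tailmon_cat tailmon_lpmon_hi // ltnW.
Qed.
End HeadFunctional.

(** * Reading a monomial back as a word *)

Section Retraction.
Variables (a b : nat).
Definition unplace (u : cmon n) : seq (k * word n) :=
  if exact_cols a b u && all (fun x => x.2 < b)%N u then [:: (1, colword 0 b u)] else [::].

Lemma unplace_perm u v : ceq u v -> lc_eq (@weq n) (unplace u) (unplace v).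
Proof.
move=> uv; apply: lc_eqW => // h ih; rewrite /unplace -(perm_exact_cols a b uv) -(perm_all _ uv).
by case: ifP => // /andP[ex _]; rewrite !ev1 (perm_colword ex uv).
Qed.

(** A repeated column fails the test. If the multiple of a run passes it, the run is a factor of the
    word that is read, so two-sidedness of [I] applies. Up to homogeneous parts, this lemma contains
    the injectivity of the embedding of A into S. *)
Lemma unplace_SI p : SI I p -> I (lin unplace p).
Proof.
apply: (SI_ind (D := fun p => I (lin unplace p))).
- by apply: subsp_lin ceqe weqe sI _ => u v; apply: unplace_perm.
- move=> i l j v; rewrite /lin /= cats0 /unplace.
  case: ifP => [/andP[ex /= /andP[jb _]]|_]; last exact: (sub_nil sI).
  by rewrite exact_cols_dup in ex.
- move=> f d s v If fd.
  have sz w : size w == d -> forall j, size (col j (lpmon s w ++ v)) =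
      ((s <= j < s + d)%N + size (col j v))%N.
    by move=> /eqP wd j; rewrite col_cat size_cat size_col_lpmon wd.
  pose u0 (w : word n) := lpmon s w ++ v.
  pose c := all (fun j => ((s <= j < s + d)%N + size (col j v) == (a <= j)%N :> nat)%N) (iota 0 b)
     && (all (fun x => x < b)%N (iota s d) && all (fun x => x.2 < b)%N v).
  have cE w : size w == d -> exact_cols a b (u0 w) && all (fun x => x.2 < b)%N (u0 w) = c.
    move=> wd; congr (_ && _); first by apply: eq_all => j; rewrite sz.
    by rewrite all_cat -(eqP wd) -map_snd_lpmon all_map.
  have evL h : ev (lin unplace (actl cat v (iotaP s f))) h =
     if c then ev f (fun w => h (colword 0 b (u0 w))) else 0.
    rewrite ev_lin ev_actl ev_iotaP.
    transitivity (ev f (fun w => if c then h (colword 0 b (u0 w)) else 0)); last exact: ev_if.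
    apply: (eq_ev_all (P := fun w : word n => size w == d) fd) => w wd; rewrite /unplace cE //.
    by case: (c); rewrite ?ev1 ?mul1r.
  case: (boolP c) => [ct|cf]; last by apply: (sub_ev0 weqe sI) => h _; rewrite evL (negPf cf).
  have [le|gt] := leqP (s + d) b.
    apply: (sub_ev weqe sI) (I_mull (colword 0 s v) (I_mulr (colword (s + d) (b - (s + d)) v) If)) _ => h _.
    rewrite evL ct ev_map ev_actl; apply: (eq_ev_all (P := fun w : word n => size w == d) fd) => w wd.
    have ex := cE w wd; rewrite ct in ex; case/andP: ex => ex _.
    by rewrite (colword_lpmon_mid _ ex) (eqP wd).
  (* A nonempty run would reach a column not below [b]. Only a run of length zero can sit at a shift
     beyond [b], and then [f] is a combination of empty words. *)
  have d0 : d = 0%N.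
    case/and3P: ct => _ /allP H _; case: d gt H {fd sz cE evL c} => // d gt /(_ (s + d)%N).
    by rewrite mem_iota leq_addr addnS leqnn => /(_ isT); lia.
  apply: (sub_ev weqe sI) (I_mull (colword 0 b v) If) _ => h _.
  rewrite evL ct ev_map; apply: (eq_ev_all (P := fun w : word n => size w == d) fd) => w /=; rewrite d0 => /nilP ->.
  by rewrite cats0.
Qed.
End Retraction.

End LetterplaceIdeal.

(** * Free modules over A and S *)

Section LinearAlgebra.
Context {k : fieldType}.

(** This is the identity Psi = Psi rho Psi for a pseudo-inverse rho. It will be applied to vectors
    whose entries lie in S, for which row reduction is not directly available. *)
Lemma ginv_exists (X Y : finType) (Psi : X -> Y -> k) : exists rho : Y -> X -> k,
  forall x y, Psi x y = \sum_z (\sum_y' Psi x y' * rho y' z) * Psi z y.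
Proof.
pose M := \matrix_(i < #|X|, j < #|Y|) Psi (enum_val i) (enum_val j).
exists (fun y x => (pinvmx M) (enum_rank y) (enum_rank x)) => x y.
have /matrixP/(_ (enum_rank x) (enum_rank y)) := mulmxKpV (submx_refl M).
rewrite [in RHS]mxE !enum_rankK => <-; rewrite mxE (reindex (@enum_rank X)) /=; last first.
  exact/onW_bij/enum_rank_bij.
apply: eq_bigr => z _; rewrite [M _ _]mxE !enum_rankK; congr (_ * _).
rewrite mxE (reindex (@enum_rank Y)) /=; last exact/onW_bij/enum_rank_bij.
by apply: eq_bigr => y' _; rewrite mxE !enum_rankK.
Qed.

(** As [U] is an arbitrary predicate, the matrix comes from excluded middle: a vector of [U] outside
    the current row space raises the rank, which cannot exceed [N]. *)
Lemma subspace_row_space N (U : 'rV[k]_N -> Prop) : U 0 ->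
  (forall u v, U u -> U v -> U (u + v)) -> (forall c u, U u -> U (c *: u)) ->
  exists A : 'M_N, forall v, U v <-> (v <= A)%MS.
Proof.
move=> U0 UD UZ.
have : forall d, (exists A : 'M_N, forall v, U v <-> (v <= A)%MS) \/
  exists A : 'M_N, (forall v, (v <= A)%MS -> U v) /\ (d <= \rank A)%N.
  elim=> [|d [|[A [AU rA]]]]; [by right; exists 0; split=> // v /submx0null ->|by left|].
  case: (classic (exists2 v, U v & ~~ (v <= A)%MS)) => [[v Uv vA]|H].
    right; exists (A + v)%MS; split.
      move=> u /sub_addsmxP[[a b] /= ->]; apply: UD; first exact/AU/submxMl.
      by rewrite [b]mx11_scalar mul_scalar_mx; apply: UZ.
    apply: leq_ltn_trans rA _; rewrite ltn_neqAle mxrankS ?addsmxSl // andbT.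
    apply: contra vA => /eqP rE; apply: submx_trans (addsmxSr A v) _.
    by have := addsmxSl A v; rewrite -(geq_leqif (mxrank_leqif_sup (addsmxSl A v))) rE.
  left; exists A => v; split; last exact: AU.
  by move=> Uv; apply/negPn/negP => vA; apply: H; exists v.
case/(_ N.+1) => // -[A [_]]; by rewrite ltnNge rank_leq_row.
Qed.

(** Words of length [m] span a finite-dimensional space, and the columns of a cokernel matrix cut
    out the part of [I] of degree [m] in it. Extended by zero to the other words, these functionals
    kill all of [I] because [I] is graded. *)
Lemma annihilator_exists n (I : seq (k * word n) -> Prop) (m : nat) : is_graded_ideal I ->
  exists q (lam : 'I_q -> word n -> k),
    (forall y f, I f -> ev f (lam y) = 0) /\
    (forall f, (forall y, ev f (lam y) = 0) -> I (deg_part size m f)).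
Proof.
move=> HI; have sI := subsp_I HI; have we : equivalence_rel (@weq n) := @eq_equiv _.
pose T := m.-tuple 'I_n; pose N := #|{: T}|.
pose ls (v : 'rV[k]_N) : seq (k * word n) := comb (fun t : T => v 0 (enum_rank t)) (fun t => [:: (1, val t)]).
have ev_ls v h : ev (ls v) h = \sum_(t : T) v 0 (enum_rank t) * h (val t).
  by rewrite ev_comb; apply: eq_bigr => t _; rewrite ev1 mul1r.
have [|u v Iu Iv|c u Iu|A HA] := @subspace_row_space N (fun v => I (ls v)).
- by apply: (sub_ev0 we sI) => h _; rewrite ev_ls big1 // => t _; rewrite mxE mul0r.
- apply: (sub_ev we sI) (sub_cat sI Iu Iv) _ => h _.
  rewrite ev_cat !ev_ls -big_split; apply: eq_bigr => t _ /=.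
  by rewrite mxE mulrDl.
- apply: (sub_ev we sI) (sub_scale sI c Iu) _ => h _.
  rewrite ev_scale !ev_ls mulr_sumr; apply: eq_bigr => t _.
  by rewrite mxE mulrA.
pose lam (y : 'I_N) (w : word n) : k := if insub w is Some t then cokermx A (@enum_rank T t) y else 0.
pose vec (f : seq (k * word n)) : 'rV[k]_N := \row_j ev f (fun w => (w == val (enum_val j))%:R).
have ev_sel f (F : T -> k) : ev f (fun w => if insub w is Some t then F t else 0) =
    \sum_(t : T) vec f 0 (enum_rank t) * F t.
  under eq_bigr do rewrite mxE enum_rankK -ev_mulr.
  rewrite -ev_sum; apply: eq_ev => w; case: insubP => [t _ <-|wm].
    rewrite (bigD1 t) //= eqxx mul1r big1 ?addr0 // => u ut.
    by rewrite (inj_eq val_inj) eq_sym (negPf ut) mul0r.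
  rewrite big1 // => t _; case: eqP => [E|_]; last by rewrite mul0r.
  by rewrite E size_tuple eqxx in wm.
have lsE f : forall h, ev (ls (vec f)) h = ev (deg_part size m f) h.
  move=> h; rewrite ev_ls -(ev_sel f (fun t => h (val t))) ev_deg_part.
  apply: eq_ev => w; case: insubP => [t wm <-|/negPf ->] //.
  by rewrite size_tuple eqxx.
have lamE f y : ev f (lam y) = (vec f *m cokermx A) 0 y.
  rewrite /lam ev_sel mxE (reindex (@enum_rank T)) //=.
  exact/onW_bij/enum_rank_bij.
have IE f : I (deg_part size m f) <-> vec f *m cokermx A = 0.
  have -> : I (deg_part size m f) <-> I (ls (vec f)).
    by split=> H; apply: (sub_ev we sI H) => h _; rewrite lsE.
  by rewrite HA submxE; split=> /eqP.
exists N, lam; split=> [y f If|f Hf].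
  by rewrite lamE ((IE f).1 (I_deg HI m If)) mxE.
by apply/IE/rowP => y; rewrite -lamE Hf mxE.
Qed.

End LinearAlgebra.

(** * The two families of graded modules and their spans *)

Section Modules.
Context {k : fieldType} {n : nat} (I : seq (k * word n) -> Prop).
Hypothesis HI : is_graded_ideal I.
Let sI := subsp_I HI.
Let sS := subsp_SI I.

Definition actA {Ix : eqType} (x : Ix * word n) (w : word n) := (x.1, x.2 ++ w).
Definition actS {Ix : eqType} (x : Ix * cmon n) (m : cmon n) := (x.1, x.2 ++ m).
Definition nullA {Ix : eqType} (p : seq (k * (Ix * word n))) := forall i, I (Defs.comp i p).
Definition nullS {Ix : eqType} (p : seq (k * (Ix * cmon n))) := forall i, SI I (Defs.comp i p).

Lemma subsp_comp (Ix : eqType) (X : Type) (e : rel X) (e' : rel (Ix * X)) N (i : Ix) :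
  equivalence_rel e -> equivalence_rel e' ->
  (forall a b, e' a b = (a.1 == b.1) && e a.2 b.2) ->
  subsp e N -> subsp e' (fun p : seq (k * _) => N (Defs.comp i p)).
Proof.
move=> ee ee' e'E sN; split.
- exact: (sub_nil sN).
- by move=> p q Np Nq; rewrite /Defs.comp filter_cat map_cat; apply: (sub_cat sN).
- move=> c p Np; apply: (sub_ev ee sN) (sub_scale sN c Np) _ => h _.
  by rewrite !(ev_scale, ev_comp).
- move=> p q /(lc_eqP ee') pq Np; apply: (sub_ev ee sN) Np _ => h ih.
  rewrite !ev_comp; apply: pq => x y; rewrite e'E => /andP[/eqP -> /ih ->] //.
Qed.
Lemma subsp_nullA (Ix : eqType) : subsp (@feq n Ix) nullA.
Proof.
apply: subsp_all => i; apply: (subsp_comp (e := @weq n)) => //; try exact: eq_equiv.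
Qed.
Lemma subsp_nullS (Ix : eqType) : subsp (@meq n Ix) nullS.
Proof.
apply: subsp_all => i; apply: (subsp_comp (e := @ceq n)) => //; first exact: ceq_equiv.
exact: meq_equiv.
Qed.

Lemma gmA (Ix : eqType) (D : Ix -> nat) :
  graded_module (@feq n Ix) actA (fun x => D x.1 + size x.2)%N size cat nullA.
Proof.
have we : equivalence_rel (@weq n) := @eq_equiv _.
split.
- exact: eq_equiv.
- by move=> x x' y /eqP ->; apply: eqxx.
- by move=> x y z; rewrite /actA catA; apply: eqxx.
- by move=> [i w] y /size0nil ->; rewrite /actA cats0.
- by move=> x x' /eqP ->.
- by move=> x y; rewrite size_cat addnA.
- by move=> x y; rewrite size_cat.
- exact: subsp_nullA.
- move=> y p Zp i; apply: (sub_ev we sI) (I_mulr HI y (Zp i)) _ => h _.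
  by rewrite ev_comp !ev_actl ev_comp.
(* In component [i], degree [d] means words of length [d - D i]. When [D i] exceeds [d], truncated
   subtraction would wrongly select the empty word, so that case is separate. *)
- move=> d p Zp i; have [di|id] := leqP (D i) d.
    apply: (sub_ev we sI) (I_deg HI (d - D i)%N (Zp i)) _ => h _.
    rewrite ev_deg_part !ev_comp ev_deg_part; apply: eq_ev => x.
    by case: eqP => [->|_]; rewrite ?if_same // -(eqn_add2l (D i)) subnKC.
  apply: (sub_ev0 we sI) => h _; rewrite ev_comp ev_deg_part ev_zero // => x.
  by case: eqP => // E; case: eqP => // xi; move: id; rewrite -E xi ltnNge leq_addr.
Qed.

Lemma gmS (Ix : eqType) (D : Ix -> nat) :
  graded_module (@meq n Ix) actS (fun x => D x.1 + size x.2)%N size cat nullS.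
Proof.
have ce := @ceq_equiv n.
split.
- exact: meq_equiv.
- by move=> x x' y /andP[/= e xx']; rewrite /meq /= e perm_cat2r.
- by move=> x y z; rewrite /actS /meq /= catA eqxx perm_refl.
- by move=> [i w] y /size0nil ->; rewrite /actS cats0.
- by move=> x x' /andP[/eqP -> /perm_size ->].
- by move=> x y; rewrite size_cat addnA.
- by move=> x y; rewrite size_cat.
- exact: subsp_nullS.
- move=> y p Zp i; apply: (sub_ev ce sS) (SI_mul y (Zp i)) _ => h _.
  by rewrite ev_comp !ev_actl ev_comp.
- move=> d p Zp i; have cP (x y : seq nat) : perm_eq x y -> (D i + size x == d)%N = (D i + size y == d)%N.
    by move/perm_size ->.
  apply: (sub_ev ce sS) (SI_filter (chi := fun c => (D i + size c == d)%N) HI cP (Zp i)) _ => h _.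
  rewrite (ev_filter (fun u : cmon n => D i + size [seq x.2 | x <- u] == d)%N).
  rewrite !ev_comp ev_deg_part; apply: eq_ev => x.
  by rewrite size_map; case: eqP => [->|_]; rewrite ?if_same.
Qed.

Lemma rspanAE (Ix : eqType) (G : seq (k * (Ix * word n)) -> Prop) p :
  rspanA I G p <-> gspan (@feq n Ix) actA nullA G p.
Proof.
have gm := gmA (fun _ : Ix => 0%N); have fe := gm_equiv gm; split.
  have sG := subsp_gspan (@feq n Ix) actA nullA G.
  elim=> {p}[p Gp| |p q _ Hp _ Hq|p f _ Hp|p q _ Hp pq].
  - exact: gspan_gen.
  - exact: (sub_nil sG).
  - exact: (sub_cat sG).
  - apply: (sub_ev fe sG) (sub_lin sG (f := fun w => actl actA w p) f _) _.
      by move=> w; apply: gspan_act.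
    move=> h _; rewrite ev_lin ev_lc_mul ev_exchange; apply: eq_ev => w.
    by rewrite ev_actl.
  - by apply: (sub_subr fe sG) Hp; apply: gspan_null.
apply.
- split; [exact: rsA_zero|exact: rsA_add| |].
  + move=> c q Hq; apply: rsA_equiv (rsA_mul [:: (c, [::])] Hq) _.
    apply: (null_of_lc_eq gm); apply: (lc_eqW fe) => h _.
    rewrite ev_lc_mul ev_scale -ev_mull; apply: eq_ev => -[i w].
    by rewrite ev1 cats0.
  + by move=> q q' qq' Hq; apply: rsA_equiv Hq _; apply: (null_of_lc_eq gm).
- move=> q Zq; apply: rsA_equiv (rsA_zero _ _) _ => i.
  apply: (sub_ev (@eq_equiv _) sI) (sub_scale sI (-1) (Zq i)) _ => h _.
  by rewrite ev_scale !ev_comp ev_sub ev_nil sub0r mulN1r.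
- by move=> q Gq; apply: rsA_gen.
- move=> y q Hq; apply: rsA_equiv (rsA_mul [:: (1, y)] Hq) _.
  apply: (null_of_lc_eq gm); apply: (lc_eqW fe) => h _.
  rewrite ev_lc_mul ev_actl; apply: eq_ev => -[i w].
  by rewrite ev1 mul1r.
Qed.

Lemma sspanE (Ix : eqType) (G : seq (k * (Ix * cmon n)) -> Prop) p :
  sspan I G p <-> gspan (@meq n Ix) actS nullS G p.
Proof.
have gm := gmS (fun _ : Ix => 0%N); have fe := gm_equiv gm; split.
  have sG := subsp_gspan (@meq n Ix) actS nullS G.
  elim=> {p}[p Gp| |p q _ Hp _ Hq|p f _ Hp|p q _ Hp pq].
  - exact: gspan_gen.
  - exact: (sub_nil sG).
  - exact: (sub_cat sG).
  - apply: (sub_ev fe sG) (sub_lin sG (f := fun w => actl actS w p) f _) _.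
      by move=> w; apply: gspan_act.
    move=> h _; rewrite ev_lin ev_lc_mul ev_exchange; apply: eq_ev => w.
    by rewrite ev_actl.
  - by apply: (sub_subr fe sG) Hp; apply: gspan_null.
apply.
- split; [exact: ss_zero|exact: ss_add| |].
  + move=> c q Hq; apply: ss_equiv (ss_mul [:: (c, [::])] Hq) _.
    apply: (null_of_lc_eq gm); apply: (lc_eqW fe) => h _.
    rewrite ev_lc_mul ev_scale -ev_mull; apply: eq_ev => -[i w].
    by rewrite ev1 cats0.
  + by move=> q q' qq' Hq; apply: ss_equiv Hq _; apply: (null_of_lc_eq gm).
- move=> q Zq; apply: ss_equiv (ss_zero _ _) _ => i.
  apply: (sub_ev (@ceq_equiv n) sS) (sub_scale sS (-1) (Zq i)) _ => h _.
  by rewrite ev_scale !ev_comp ev_sub ev_nil sub0r mulN1r.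
- by move=> q Gq; apply: ss_gen.
- move=> y q Hq; apply: ss_equiv (ss_mul [:: (1, y)] Hq) _.
  apply: (null_of_lc_eq gm); apply: (lc_eqW fe) => h _.
  rewrite ev_lc_mul ev_actl; apply: eq_ev => -[i w].
  by rewrite ev1 mul1r.
Qed.

End Modules.

(** * Syzygies *)

Section ColumnDecomposition.
Context {n : nat}.
Implicit Types (u : cmon n) (v : word n) (a m j : nat).

Lemma colword_rcons m u : colword 0 m.+1 u = colword 0 m u ++ col m u.
Proof. by rewrite -addn1 colword_add /= add0n /colword /= cats0. Qed.
Lemma exact_colsS a m u :
  exact_cols a m.+1 u = exact_cols a m u && (size (col m u) == (a <= m)%N :> nat).
Proof. by rewrite /exact_cols -addn1 iotaD all_cat /= andbT. Qed.
Lemma size_colword a m u : exact_cols a m u -> size (colword 0 m u) = (m - a)%N.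
Proof.
elim: m => // m IH; rewrite exact_colsS => /andP[/IH e /eqP sm].
by rewrite colword_rcons size_cat e sm; case: leqP; lia.
Qed.
Lemma col_letters m u : [seq x <- u | x.2 == m] = [seq (i, m) | i <- col m u].
Proof.
elim: u => //= -[i j] u IH; rewrite /col /= ; case: eqP => //= ->.
by rewrite -/(col m u) IH.
Qed.
Lemma perm_col_split m u : perm_eq u ([seq (i, m) | i <- col m u] ++ [seq x <- u | x.2 != m]).
Proof. by rewrite -col_letters perm_sym; apply/permPl/perm_filterC. Qed.
(** The proof moves one column at a time from the tail to the end of the placed word. Columns before
    [a] are empty, so the reading from column 0 starts in effect at [a]. *)
Lemma perm_exact a m u : exact_cols a m u ->
  perm_eq u (lpmon a (colword 0 m u) ++ tailmon m u).
Proof.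
elim: m => [|m IH].
  by move=> _; rewrite /tailmon (@eq_filter _ _ predT) ?filter_predT.
rewrite exact_colsS => /andP[ex /eqP sm]; apply: perm_trans (IH ex) _.
rewrite colword_rcons lpmon_cat -catA perm_cat2l (size_colword ex).
have tE : perm_eq (tailmon m u) ([seq (i, m) | i <- col m u] ++ tailmon m.+1 u).
  rewrite -col_letters perm_sym.
  have -> : [seq x <- u | x.2 == m] = [seq x <- tailmon m u | x.2 == m].
    by rewrite -filter_predI; apply: eq_filter => x /=; case: eqP => // ->; rewrite leqnn.
  have -> : tailmon m.+1 u = [seq x <- tailmon m u | x.2 != m].
    by rewrite -filter_predI; apply: eq_filter => x /=; rewrite ltn_neqAle eq_sym.
  exact/permPl/perm_filterC.
apply: perm_trans tE _; rewrite perm_cat2r.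
case: leqP sm => am sm; last by rewrite (size0nil sm).
case: (col m u) sm => [|i [|? ?]] //= _; rewrite subnKC //.
Qed.
Lemma exact_cols_shift a m u v : size v = a -> (a <= m)%N -> exact_cols a m u ->
  exact_cols 0 m (lpmon 0 v ++ u).
Proof.
move=> <- am /exact_colsP ex; apply/exact_colsP => j jm.
by rewrite col_cat size_cat size_col_lpmon add0n ex //; case: leqP.
Qed.
Lemma colword_shift a m u v : size v = a -> (a <= m)%N -> exact_cols a m u ->
  colword 0 m (lpmon 0 v ++ u) = v ++ colword 0 m u.
Proof.
move=> va am ex; have ex' := exact_cols_shift va am ex.
rewrite (colword_lpmon_mid _ ex') ?add0n ?va // /= -[in RHS](subnKC am) colword_add add0n.
rewrite [X in _ = _ ++ (X ++ _)]colword_nil // => j /andP[_ ja]; apply/size0nil.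
by move/exact_colsP: ex => ->; rewrite ?(leq_trans ja) // leqNgt ja.
Qed.

Lemma missing_col_exists a u : exists m, (a <= m)%N && (col m u == [::]).
Proof.
(* This number exceeds every column that occurs in [u]. *)
exists (a + \sum_(x <- u) x.2.+1)%N; rewrite leq_addr -size_eq0 size_colE /=.
rewrite -leqn0 leqNgt -has_count; apply/hasPn => y /mapP[x xu ->] /=.
rewrite (big_rem x) //=; apply/eqP; lia.
Qed.
Definition missing_col a u := ex_minn (missing_col_exists a u).
Lemma missing_colP a u : [/\ (a <= missing_col a u)%N, col (missing_col a u) u = [::] &
  forall j, (a <= j < missing_col a u)%N -> col j u != [::]].
Proof.
rewrite /missing_col; case: ex_minnP => m /andP[am /eqP cm] mm; split=> // j /andP[aj jm].
by apply/negP => cj; have := mm j; rewrite aj cj leqNgt jm => /(_ isT).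
Qed.
End ColumnDecomposition.

Section Syzygies.
Context {k : fieldType} {n : nat} (I : seq (k * word n) -> Prop).
Hypothesis HI : is_graded_ideal I.
Variables (r s : nat) (g : 'I_s -> seq (k * ('I_r * word n))) (Delta : 'I_s -> nat).
Hypothesis Hg : forall j, all (fun t => size t.2.2 == Delta j) (g j).
Let sI := subsp_I HI.
Let sS := subsp_SI I.
Let we : equivalence_rel (@weq n) := @eq_equiv _.
Let ce : equivalence_rel (@ceq n) := ceq_equiv.
Notation me := (@meq_equiv n _).

Lemma eq_ev_g j h h' : (forall x, size x.2 = Delta j -> h x = h' x) -> ev (g j) h = ev (g j) h'.
Proof.
by move=> H; apply: (eq_ev_all (P := fun x => size x.2 == Delta j) (Hg j)) => x /eqP/H.
Qed.
Lemma ev_phiA p h : ev (phiA g p) h =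
  ev p (fun x => ev (g x.1) (fun v => h (v.1, v.2 ++ x.2))).
Proof.
rewrite ev_flatten big_map [RHS]evE; apply: eq_bigr => t _; rewrite !evE big_map mulr_sumr.
by apply: eq_bigr => v _; rewrite mulrA.
Qed.
Lemma ev_iotaM (Ix : eqType) (D : Ix -> nat) (p : seq (k * (Ix * word n))) h :
  ev (iotaM D p) h = ev p (fun x => h (x.1, lpmon (D x.1) x.2)).
Proof. exact: ev_map. Qed.
Lemma null_iotaM (Ix : eqType) (D : Ix -> nat) (p : seq (k * (Ix * word n))) :
  nullA I p -> nullS I (iotaM D p).
Proof.
move=> Zp i; apply: (sub_ev ce sS) (SI_iota (D i) (Zp i)) _ => h _.
rewrite ev_iotaP !ev_comp ev_iotaM; apply: eq_ev => x /=.
by case: eqP => // ->.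
Qed.
Lemma ev_phiS p h : ev (phiS g p) h =
  ev p (fun x => ev (g x.1) (fun v => h (v.1, lpmon 0 v.2 ++ x.2))).
Proof.
rewrite ev_flatten big_map [RHS]evE; apply: eq_bigr => t _.
rewrite !evE !big_map mulr_sumr.
by apply: eq_bigr => v _; rewrite mulrA.
Qed.
Lemma kerAE p : kerA I g p <-> nullA I (phiA g p).
Proof.
split=> H i; apply: (sub_ev we sI (H i)) => h _; by rewrite !ev_comp ev_sub ev_nil subr0.
Qed.
Lemma kerSE p : kerS I g p <-> nullS I (phiS g p).
Proof.
split=> H i; apply: (sub_ev ce sS (H i)) => h _; by rewrite !ev_comp ev_sub ev_nil subr0.
Qed.

Lemma subsp_kerS : subsp (@meq n _) (kerS I g).
Proof.
have sN := subsp_nullS I 'I_r; split.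
- by apply/kerSE; apply: (sub_nil sN).
- move=> p q /kerSE Hp /kerSE Hq; apply/kerSE; apply: (sub_ev me sN) (sub_cat sN Hp Hq) _ => h _.
  by rewrite ev_cat !ev_phiS ev_cat.
- move=> c p /kerSE Hp; apply/kerSE; apply: (sub_ev me sN) (sub_scale sN c Hp) _ => h _.
  by rewrite ev_scale !ev_phiS ev_scale.
- move=> p q /(lc_eqP me) pq /kerSE Hp; apply/kerSE; apply: (sub_ev me sN) Hp _ => h ih.
  rewrite !ev_phiS; apply: pq => x y /andP[/eqP -> xy]; apply: eq_ev => v; apply: ih.
  by rewrite /meq eqxx perm_cat2l.
Qed.
Lemma nullS_kerS p : nullS I p -> kerS I g p.
Proof.
move=> Zp; apply/kerSE => i.
pose f j (v : 'I_r * word n) := if v.1 == i then actl cat (lpmon 0 v.2) (Defs.comp j p) else [::].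
apply: (sub_ev ce sS) (sub_flatten sS (f := fun j => lin (f j) (g j)) (index_enum 'I_s) _) _.
  move=> j; apply: (sub_lin sS) => v; rewrite /f; case: ifP => _; last exact: (sub_nil sS).
  exact: SI_mul.
move=> h ih; rewrite ev_flatten big_map ev_comp ev_phiS.
transitivity (\sum_j ev p (fun x => if x.1 == j then ev (g j) (fun v => if v.1 == i then h (lpmon 0 v.2 ++ x.2) else 0) else 0)).
  apply: eq_bigr => j _; rewrite ev_lin /f.
  transitivity (ev (g j) (fun v => ev p (fun x => if x.1 == j then (if v.1 == i then h (lpmon 0 v.2 ++ x.2) else 0) else 0))).
    apply: eq_ev => v; case: ifP => _; last first.
      by rewrite ev_nil ev_zero // => x; case: ifP.
    rewrite ev_actl ev_comp; apply: eq_ev => x; case: ifP => // _.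
    by apply: ih; rewrite /ceq perm_catC.
  by rewrite ev_exchange; apply: eq_ev => x; rewrite ev_if.
rewrite -ev_sum; apply: eq_ev => x; rewrite (bigD1 x.1) //= eqxx big1 ?addr0 //.
by move=> j /negPf; rewrite eq_sym => ->.
Qed.
Lemma kerS_act y p : kerS I g p -> kerS I g (actl actS y p).
Proof.
move=> /kerSE Zp; apply/kerSE.
apply: (sub_ev me (subsp_nullS I _) (gm_null_act (gmS HI (fun=> 0%N)) y Zp)) => h _.
rewrite ev_actl !ev_phiS ev_actl; apply: eq_ev => x; apply: eq_ev => v.
by rewrite /actS /= catA.
Qed.

Lemma SI_repeated_col u c : (1 < size (col c u))%N -> SI I [:: (1, u)].
Proof.
have := perm_col_split c u; case: (col c u) => [|i [|l w]] //= pu _.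
apply: (sub_ev ce sS) (SI_dup I i l c _) _ => h ih; rewrite !ev1; congr (_ * _).
by apply: ih; rewrite /ceq perm_sym; apply: pu.
Qed.

(** Each term of the image of [g j] occupies all columns below [Delta j]. Multiplying by a variable
    of such a column repeats that column, and the result lies in Q. *)
Lemma kerS_C p : Cmod I Delta p -> kerS I g p.
Proof.
move/(sspanE HI); apply; first exact: subsp_kerS.
- exact: nullS_kerS.
- move=> _ [j [i [c [cj ->]]]]; apply/kerSE => i'.
  pose f (v : 'I_r * word n) := if v.1 == i' then [:: (1 : k, lpmon 0 v.2 ++ [:: (i, c)])] else [::].
  apply: (sub_ev ce sS) (sub_lin_all sS (P := fun v => size v.2 == Delta j) (f := f) (Hg j) _) _.
    move=> v /eqP vj; rewrite /f; case: ifP => _; last exact: (sub_nil sS).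
    apply: (SI_repeated_col (c := c)).
    by rewrite col_cat size_cat size_col_lpmon vj add0n cj /col /= eqxx.
  move=> h _; rewrite ev_lin ev_comp ev_phiS ev1 mul1r; apply: eq_ev => v.
  by rewrite /f; case: ifP => _; rewrite ?ev_nil ?ev1 ?mul1r.
- by move=> y q; apply: kerS_act.
Qed.
(** The shift [Delta j] places a word directly behind the words of [g j], so the letterplace
    embedding intertwines [phiA] and [phiS]. *)
Lemma kerS_iotaM p : kerA I g p -> kerS I g (iotaM Delta p).
Proof.
move=> /kerAE Kp; apply/kerSE => i.
apply: (sub_ev ce sS) (SI_iota 0 (Kp i)) _ => h _.
rewrite ev_iotaP !ev_comp ev_phiA ev_phiS ev_iotaM; apply: eq_ev => x.
by apply: eq_ev_g => v vj; rewrite lpmon_cat vj.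
Qed.
Lemma kerS_LK p : LK I g Delta p -> kerS I g p.
Proof.
move/(sspanE HI); apply; first exact: subsp_kerS.
- exact: nullS_kerS.
- by move=> _ [q Kq ->]; apply: kerS_iotaM.
- by move=> y q; apply: kerS_act.
Qed.

Let CLK := sspan I (fun q => Cmod I Delta q \/ LK I g Delta q).
Lemma subsp_sspan (Ix : eqType) (G : seq (k * (Ix * cmon n)) -> Prop) : subsp (@meq n Ix) (sspan I G).
Proof.
have sG := subsp_gspan (@meq n Ix) actS (nullS I) G.
split.
- by apply/(sspanE HI); apply: (sub_nil sG).
- by move=> p q /(sspanE HI) Hp /(sspanE HI) Hq; apply/(sspanE HI); apply: (sub_cat sG).
- by move=> c p /(sspanE HI) Hp; apply/(sspanE HI); apply: (sub_scale sG).
- by move=> p q pq /(sspanE HI) Hp; apply/(sspanE HI); apply: (sub_eq sG) pq _.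
Qed.
Lemma sspan_null (Ix : eqType) (G : seq (k * (Ix * cmon n)) -> Prop) p : nullS I p -> sspan I G p.
Proof. by move=> Zp; apply/(sspanE HI); apply: gspan_null. Qed.
Lemma sspan_act (Ix : eqType) (G : seq (k * (Ix * cmon n)) -> Prop) y p :
  sspan I G p -> sspan I G (actl actS y p).
Proof. by move=> /(sspanE HI) Hp; apply/(sspanE HI); apply: gspan_act. Qed.

Lemma kerS_CLK p : CLK p -> kerS I g p.
Proof.
move/(sspanE HI); apply; first exact: subsp_kerS.
- exact: nullS_kerS.
- by move=> q [/kerS_C|/kerS_LK].
- by move=> y q; apply: kerS_act.
Qed.

Lemma Cmod_col_lt (x : 'I_s * cmon n) c : (c < Delta x.1)%N -> col c x.2 != [::] ->
  Cmod I Delta [:: (1, x)].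
Proof.
move=> cx; have := perm_col_split c x.2; case: (col c x.2) => [|i w] //= pu _.
set w' := _ ++ _ in pu.
have sC : subsp (@meq n _) (Cmod I Delta) by apply: subsp_sspan.
have Cg : Cmod I Delta [:: (1, (x.1, [:: (i, c)]))] by apply: ss_gen; exists x.1, i, c.
apply: (sub_ev me sC (sspan_act w' Cg)).
move=> h ih; rewrite ev_actl !ev1; congr (_ * _); apply: ih.
by rewrite /meq /= eqxx /= perm_sym.
Qed.

Let mis (x : 'I_s * cmon n) := missing_col (Delta x.1) x.2.
Let good (x : 'I_s * cmon n) := exact_cols (Delta x.1) (mis x) x.2.

(** Exactness can fail in two ways: a letter stands in a column below [Delta], and the monomial lies
    in C, or a column between [Delta] and the missing one is repeated, and the monomial is zero in
    S. *)
Lemma CLK_not_good x : ~~ good x -> CLK [:: (1, x)].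
Proof.
have [am cm cj] := missing_colP (Delta x.1) x.2.
case/allPn => c; rewrite mem_iota /= add0n => cm' sc.
have [dc|cd] := leqP (Delta x.1) c; last first.
  apply: ss_gen; left; apply: Cmod_col_lt (cd) _.
  by move: sc; rewrite leqNgt cd /= size_eq0.
apply: sspan_null => i.
have S1 : SI I [:: (1, x.2)].
  apply: (SI_repeated_col (c := c)); move: sc (cj c); rewrite dc cm' -size_eq0.
  by case: (size _) => [|[|]] // _ /(_ isT).
have [E|ne] := eqVneq x.1 i.
  by apply: (sub_ev ce sS) S1 _ => h _; rewrite ev_comp !ev1 E eqxx.
by apply: (sub_ev0 ce sS) => h _; rewrite ev_comp ev1 (negPf ne) mulr0.
Qed.

(** * The part of a kernel element with a given first missing column *)

Section FixedMissingColumn.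
Variables (m : nat) (p : seq (k * ('I_s * cmon n))).
Hypothesis goodp : all (fun t => good t.2) p.
Hypothesis Kp : kerS I g p.

Let key (z : 'I_s * cmon n) : 'I_s * word n := (z.1, colword 0 m z.2).
Let sel (z : 'I_s * cmon n) := good z && (mis z == m).
(** These are the possible heads. Fixing [m] fixes the length of the word for each generator, and
    bounded sequences make the set a finite type. *)
Let X := {x : 'I_s * {bseq m of 'I_n} | (Delta x.1 + size x.2 == m)%N}.
Let vx (x : X) : 'I_s * word n := ((val x).1, val (val x).2).
Let u (x : X) : seq (k * cmon n) :=
  [seq (t.1, tailmon m t.2.2) | t <- [seq t <- p | sel t.2 && (key t.2 == vx x)]].

Lemma ev_u x h : ev (u x) h = ev p (fun z => if sel z && (key z == vx x) then h (tailmon m z.2) else 0).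
Proof.
rewrite /u (ev_map (fun z : 'I_s * cmon n => tailmon m z.2)).
by rewrite (ev_filter (fun z => sel z && (key z == vx x))).
Qed.
Lemma sum_key z (F : 'I_s * word n -> k) : sel z ->
  \sum_x (if sel z && (key z == vx x) then F (vx x) else 0) = F (key z).
Proof.
move=> sz; have /andP[gz /eqP mz] := sz.
have [am _ _] := missing_colP (Delta z.1) z.2.
have sk : size (key z).2 = (m - Delta z.1)%N by apply: size_colword; rewrite -mz.
have kb : (size (key z).2 <= m)%N by rewrite sk leq_subr.
have kP : (Delta (z.1, Bseq kb).1 + size (z.1, Bseq kb).2 == m)%N.
  by rewrite /= sk subnKC // -mz.
pose x0 : X := exist _ (z.1, Bseq kb) kP.
rewrite (bigD1 x0) //= sz big1 => [|x xx0].
  by rewrite /vx /= eqxx addr0.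
case: eqP => // E; case/eqP: xx0; apply/val_inj.
case: x E => -[j w] /= pw; rewrite /vx /= => -[-> E]; congr (_, _).
exact/val_inj.
Qed.

(** The word [v] fills the columns below [Delta] and [z] fills those up to [mis z], so the product
    has first missing column [mis z]. The functional of level [m] thus sees exactly the terms of [p]
    with missing column [m]. *)
Lemma head_lam_sel (lam : word n -> k) z v : good z -> size v = Delta z.1 ->
  head_lam m lam (lpmon 0 v ++ z.2) =
  if sel z then [:: (lam (v ++ (key z).2), tailmon m z.2)] else [::].
Proof.
move=> gz vz; have [am cm cj] := missing_colP (Delta z.1) z.2.
rewrite /sel gz /=; case: eqP => [mz|ne].
  rewrite -/(mis z) mz in am cm; rewrite /good mz in gz.
  rewrite /head_lam (exact_cols_shift vz) // col_cat cm col_lpmon_nil; last by rewrite vz; lia.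
  by rewrite /= (colword_shift vz) // tailmon_cat tailmon_lpmon_lo // vz.
rewrite /head_lam; case: ifP => // /andP[/exact_colsP ex /eqP cm0].
have [lt|ge] := ltnP m (mis z).
  have := congr1 size cm0; rewrite col_cat size_cat size_col_lpmon vz.
  by move/exact_colsP: gz => /(_ _ lt) ->; case: leqP.
have lt : (mis z < m)%N by rewrite ltn_neqAle ge andbT; apply/eqP.
have := ex _ lt; rewrite col_cat size_cat size_col_lpmon vz cm /=.
by rewrite add0n ltnNge am.
Qed.

(** The tails [u x] form a row with entries in S that satisfies a scalar linear system. Splitting it
    by a generalized inverse writes this part of [p] as multiples of placed syzygies plus a null
    element. *)
Lemma CLK_fixed_missing : CLK (deg_part mis m p).
Proof.
have [q [lam [lam0 lamI]]] := annihilator_exists m HI.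
pose Y := ('I_q * 'I_r)%type.
(* Rows are heads and columns are pairs of a functional and a component of the target. A scalar
   combination of heads is a syzygy exactly when its coefficients annihilate this matrix. *)
pose psi (x : 'I_s * word n) (y : Y) := ev (g x.1) (fun v => if v.1 == y.2 then lam y.1 (v.2 ++ x.2) else 0).
have [rho Hrho] := ginv_exists (fun (x : X) (y : Y) => psi (vx x) y).
pose pi x z := \sum_y psi (vx x) y * rho y z.
(* This is the equation for column [y]: the head functional applied to one component of the image of
   [p]. It vanishes in S, and [evL] rewrites it as a relation between the tails. *)
pose L (y : Y) := lin (head_lam m (lam y.1)) (Defs.comp y.2 (phiS g p)).
have SL y : SI I (L y).
  by move/kerSE: (Kp) => Kp0; rewrite /L; exact: (SI_head_lam HI m (lam0 y.1) (Kp0 y.2)).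
have evL y h : ev (L y) h = \sum_x psi (vx x) y * ev (u x) h.
  rewrite ev_lin ev_comp ev_phiS.
  transitivity (ev p (fun z => if sel z then psi (key z) y * h (tailmon m z.2) else 0)).
    apply: (eq_ev_all (P := good) goodp) => z gz.
    transitivity (ev (g z.1) (fun v => if sel z then (if v.1 == y.2 then lam y.1 (v.2 ++ (key z).2) else 0) * h (tailmon m z.2) else 0)).
      apply: eq_ev_g => v vz; rewrite head_lam_sel //; case: (sel z); case: ifP => _;
      by rewrite ?ev1 ?ev_nil ?mul0r.
    by rewrite ev_if ev_mulr.
  under eq_bigr do rewrite ev_u -ev_mull.
  rewrite -ev_sum; apply: eq_ev => z; case: ifP => sz; last by rewrite big1 // => x _; rewrite mulr0.
  rewrite -(sum_key (fun x => psi x y * h (tailmon m z.2)) sz) sz.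
  by apply: eq_bigr => x _ /=; case: ifP; rewrite ?mulr0.
(* These are the rows of the identity minus [pi]. Since [pi] fixes the matrix of [psi] from the
   left, they annihilate that matrix and lie in K. *)
pose kap (x : X) : seq (k * ('I_s * word n)) :=
  (1, vx x) :: comb (fun z => - pi x z) (fun z => [:: (1, vx z)]).
have ev_kap x h : ev (kap x) h = h (vx x) - \sum_z pi x z * h (vx z).
  rewrite ev_cons mul1r ev_comb -sumrN; congr (_ + _); apply: eq_bigr => z _.
  by rewrite ev1 mul1r mulNr.
have Kkap x : kerA I g (kap x).
  apply/kerAE => i; apply: (sub_ev we sI) (lamI (Defs.comp i (phiA g (kap x))) _) _.
    move=> y; rewrite ev_comp ev_phiA ev_kap.
    have := Hrho x (y, i); rewrite /psi /= => ->; exact: subrr.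
  move=> h _; rewrite ev_deg_part !ev_comp !ev_phiA !ev_kap.
  have E z : ev (g (vx z).1) (fun v => if v.1 == i then (if size (v.2 ++ (vx z).2) == m then h (v.2 ++ (vx z).2) else 0) else 0)
    = ev (g (vx z).1) (fun v => if v.1 == i then h (v.2 ++ (vx z).2) else 0).
    apply: eq_ev_g => v vz; rewrite size_cat vz /vx /=.
    by have /eqP -> := valP z; rewrite eqxx.
  rewrite /= E; congr (_ - _); apply: eq_bigr => z _; congr (_ * _); exact: E.
pose H h (x : 'I_s * word n) c := h (x.1, lpmon (Delta x.1) x.2 ++ c) : k.
(* The row of tails u is split as u (1 - pi) + (u Psi) rho. The sum of the [l1] is the first part,
   in L(K); the sum of the [l2] is the second, null because each entry [L y] of u Psi is. *)
pose l1 x := lin (fun c => actl actS c (iotaM Delta (kap x))) (u x).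
pose S z := comb (fun y => rho y z) L.
pose l2 (z : X) := [seq (t.1, ((vx z).1, lpmon (Delta (vx z).1) (vx z).2 ++ t.2)) | t <- S z].
have sC : subsp (@meq n _) CLK by apply: subsp_sspan.
have C1 x : CLK (l1 x).
  apply: (sub_lin sC) => c; apply: sspan_act; apply: ss_gen; right; apply: ss_gen.
  by exists (kap x).
have C2 z : CLK (l2 z).
  apply: sspan_null => i; have [E|ne] := eqVneq (vx z).1 i; last first.
    apply: (sub_ev0 ce sS) => h _; rewrite ev_comp /l2 (ev_map (fun c => ((vx z).1, lpmon (Delta (vx z).1) (vx z).2 ++ c))) ev_zero // => x /=.
    by rewrite (negPf ne).
  apply: (sub_ev ce sS) (SI_mul (lpmon (Delta (vx z).1) (vx z).2) (sub_comb sS (fun y => rho y z) SL)) _ => h ih.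
  rewrite ev_actl ev_comp /l2 (ev_map (fun c => ((vx z).1, lpmon (Delta (vx z).1) (vx z).2 ++ c))).
  apply: eq_ev => c; move: (E) => /= ->; rewrite eqxx; apply: ih.
  by rewrite /ceq perm_catC.
apply: (sub_ev me sC) (sub_cat sC (sub_flatten sC (index_enum X) C1) (sub_flatten sC (index_enum X) C2)) _ => h ih.
rewrite ev_cat !ev_flatten !big_map.
have -> : ev (deg_part mis m p) h = \sum_x ev (u x) (H h (vx x)).
  under eq_bigr do rewrite ev_u.
  rewrite -ev_sum ev_deg_part; apply: (eq_ev_all (P := good) goodp) => z gz.
  have [mz|ne] := eqVneq (mis z) m; last first.
    by rewrite big1 // => x _; rewrite /sel (negPf ne) andbF.
  have sz : sel z by rewrite /sel gz mz eqxx.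
  rewrite (sum_key (fun x => H h x (tailmon m z.2)) sz).
  apply: ih; rewrite /meq eqxx /=; apply: perm_exact; by rewrite -mz.
have E1 x : ev (l1 x) h = ev (u x) (H h (vx x)) - \sum_z pi x z * ev (u x) (H h (vx z)).
  rewrite ev_lin -[X in _ - X](eq_bigr _ (fun z _ => ev_mull _ _ _)) -ev_sum -mulN1r -ev_mull -ev_add.
  apply: eq_ev => c; rewrite ev_actl ev_iotaM ev_kap mulN1r //.
have E2 z : ev (l2 z) h = \sum_x pi x z * ev (u x) (H h (vx z)).
  rewrite /l2 (ev_map (fun c => ((vx z).1, lpmon (Delta (vx z).1) (vx z).2 ++ c))) ev_comb.
  transitivity (\sum_y \sum_x rho y z * (psi (vx x) y * ev (u x) (H h (vx z)))).
    by apply: eq_bigr => y _; rewrite evL mulr_sumr.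
  rewrite exchange_big; apply: eq_bigr => x _; rewrite /pi mulr_suml; apply: eq_bigr => y _.
  by rewrite mulrCA mulrA.
under eq_bigr do rewrite E1.
under [X in _ + X]eq_bigr do rewrite E2.
by rewrite sumrB [X in _ - X]exchange_big subrK.
Qed.

End FixedMissingColumn.

(** Monomials that are not good lie in C up to null elements, so removing them stays in the kernel.
    The rest is a finite sum of parts with a given missing column. *)
Lemma kerS_eq_CLK p : kerS I g p <-> CLK p.
Proof.
split; last exact: kerS_CLK.
have sC : subsp (@meq n _) CLK by apply: subsp_sspan.
move=> Kp; pose b := [seq t <- p | ~~ good t.2]; pose p' := [seq t <- p | good t.2].
have evb h : ev p h = ev b h + ev p' h.
  rewrite (ev_filter (fun x => ~~ good x)) (ev_filter good) -ev_add.
  by apply: eq_ev => x; case: (good x); rewrite ?addr0 ?add0r.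
have Cb : CLK b.
  apply: (sub_ev me sC) (sub_lin_all sC (P := fun x => ~~ good x) (f := fun x => [:: (1, x)]) (filter_all _ p) CLK_not_good) _.
  by move=> h _; rewrite ev_lin; apply: eq_ev => x; rewrite ev1 mul1r.
have Kp' : kerS I g p'.
  apply: (sub_ev me subsp_kerS) (sub_sub subsp_kerS Kp (kerS_CLK Cb)) _ => h _.
  by rewrite ev_sub evb addrC addKr.
have Cp' : CLK p'.
  have [M HM] := deg_part_sum mis p'.
  apply: (sub_ev me sC) (sub_flatten sC (f := fun m : 'I_M => deg_part mis m p') (index_enum 'I_M) _) _.
    by move=> m; apply: CLK_fixed_missing => //; apply: filter_all.
  by move=> h _; rewrite ev_flatten big_map HM.
apply: (sub_ev me sC) (sub_cat sC Cb Cp') _ => h _.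
by rewrite ev_cat evb.
Qed.

End Syzygies.

(** * Counting basis elements *)

Section Unplacing.
Context {k : fieldType} {n : nat}.
Lemma size_exact a d (u : cmon n) : exact_cols a d u -> all (fun x => x.2 < d)%N u ->
  size u = (d - a)%N.
Proof.
move=> ex /allP lt; rewrite (perm_size (perm_exact ex)) size_cat size_lpmon (size_colword ex).
rewrite (_ : tailmon d u = [::]) ?addn0 //; apply/eqP; rewrite -[_ == _]negbK -has_filter.
by apply/hasPn => x /lt; rewrite ltnNge.
Qed.
(** The side condition excludes the empty monomial at a shift beyond [d], which passes the test of
    [unplace] vacuously and would be read as the empty word. *)
Lemma unplace_lpmon (a d e : nat) (w : word n) (y : cmon n) : (a + size w = e)%N ->
  (e <= d)%N || (0 < size y)%N ->
  unplace a d (lpmon a w ++ y) = if [&& (e <= d)%N, exact_cols e d y & all (fun x => x.2 < d)%N y]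
    then [:: (1, w ++ colword 0 d y)] else [::] :> seq (k * _).
Proof.
move=> we hy; rewrite /unplace.
have [le|gt] /= := leqP e d; last first.
  case: ifP => // /andP[ex al]; have := size_exact ex al.
  rewrite size_cat size_lpmon; move: hy; rewrite leqNgt gt /=; lia.
have exE : exact_cols a d (lpmon a w ++ y) = exact_cols e d y.
  apply: eq_all => c; rewrite col_cat size_cat size_col_lpmon we.
  by have [|] := leqP a c; have [|] := leqP e c; lia.
have -> : all (fun x => x.2 < d)%N (lpmon a w ++ y) = all (fun x => x.2 < d)%N y.
  rewrite all_cat -[X in X && _](all_map (fun x => x.2) (fun c => c < d)%N) map_snd_lpmon.
  rewrite (_ : all _ _) //; apply/allP => c; rewrite mem_iota; lia.
rewrite exE; case: ifP => // /andP[ex _]; congr [:: (_, _)].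
rewrite (@colword_lpmon_mid _ a) ?we ?exE // -[in RHS](subnKC le) colword_add add0n.
move/exact_colsP: ex => ex.
rewrite [colword 0 a y]colword_nil ?[colword 0 e y]colword_nil // => c cc; apply/size0nil.
- by rewrite ex; lia.
- by rewrite ex; lia.
Qed.
End Unplacing.

Section BasisCounts.
Context {k : fieldType} {n : nat} (I : seq (k * word n) -> Prop).
Hypothesis HI : is_graded_ideal I.
Variables (r s : nat) (g : 'I_s -> seq (k * ('I_r * word n))) (Delta : 'I_s -> nat).
Hypothesis Hg : forall j, all (fun t => size t.2.2 == Delta j) (g j).
Hypothesis Hmin : forall j, ~ rspanA I (fun p => exists2 l, l != j & p = g l) (g j).
Let sI := subsp_I HI.
Let sS := subsp_SI I.
Let we : equivalence_rel (@weq n) := @eq_equiv _.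
Let ce : equivalence_rel (@ceq n) := ceq_equiv.
Notation fe := (@feq_equiv n _).
Notation me := (@meq_equiv n _).
Let gA := gmA HI Delta.
Let gS := gmS HI Delta.
Let dA (x : 'I_s * word n) := (Delta x.1 + size x.2)%N.
Let dS (x : 'I_s * cmon n) := (Delta x.1 + size x.2)%N.
Let zA : seq (k * ('I_s * word n)) -> Prop := nullA I.
Let zS : seq (k * ('I_s * cmon n)) -> Prop := nullS I.
Let szA : subsp (@feq n 'I_s) zA := subsp_nullA HI 'I_s.
Let szS : subsp (@meq n 'I_s) zS := subsp_nullS I 'I_s.
Let hA := hdeg (@feq n 'I_s) dA zA.
Let hS := hdeg (@meq n 'I_s) dS zS.
Let gspA := gspan (@feq n 'I_s) actA zA.
Let gspS := gspan (@meq n 'I_s) actS zS.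
Let augA := aug (@feq n 'I_s) actA size zA.
Let augS := aug (@meq n 'I_s) actS size zS.
Let io : seq (k * ('I_s * word n)) -> seq (k * ('I_s * cmon n)) := iotaM Delta.
Let C := Cmod I Delta : seq (k * ('I_s * cmon n)) -> Prop.

(* A nonzero constant coefficient of a syzygy would express g_j by the other generators. *)
Lemma kerA_const_coef p j : kerA I g p -> ev p (fun x => (x == (j, [::]))%:R) = 0.
Proof.
move=> /(kerAE HI) Zp; apply: NNPP => /eqP cj; apply: (Hmin (j := j)).
set c := ev _ _ in cj; apply/(rspanAE HI).
pose G (q : seq (k * ('I_r * word n))) := exists2 l, l != j & q = g l.
have sG := subsp_gspan (@feq n 'I_r) actA (nullA I) G.
have Zd := gm_null_deg (gmA HI (fun _ : 'I_r => 0%N)) (Delta j) Zp.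
pose f (x : 'I_s * word n) := if (x.1 != j) && (dA x == Delta j) then actl actA x.2 (g x.1) else [::].
have Gf : gspan (@feq n 'I_r) actA (nullA I) G (lin f p).
  apply: (sub_lin sG) => x; rewrite /f; case: ifP => [/andP[xj _]|_]; last exact: (sub_nil sG).
  by apply: gspan_act; apply: gspan_gen; exists x.1.
apply: (sub_ev fe sG) (sub_scale sG c^-1 (sub_sub sG (gspan_null Zd) Gf)) _ => h _.
rewrite ev_scale ev_sub ev_deg_part ev_phiA ev_lin.
apply: (mulfI cj); rewrite mulVKf // /c -ev_mulr; apply/eqP; rewrite subr_eq -ev_add; apply/eqP.
apply: eq_ev => -[l w] /=.
transitivity (if dA (l, w) == Delta j then ev (g l) (fun v => h (v.1, v.2 ++ w)) else 0).
  rewrite -ev_if; apply: eq_ev_g => // v vl; rewrite /= size_cat vl add0n.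
  by rewrite /dA.
rewrite /f /= xpair_eqE; have [->|lj] := eqVneq l j; last first.
  by rewrite /= mul0r add0r; case: ifP; rewrite ?ev_nil // ev_actl.
rewrite ev_nil addr0 /dA /= -[X in _ == X]addn0 eqn_add2l size_eq0.
case: eqP => [->|_]; last by rewrite mul0r.
by rewrite mul1r; apply: eq_ev => -[i v]; rewrite cats0.
Qed.

Lemma null_io p : zA p -> zS (io p). Proof. exact: null_iotaM. Qed.
Lemma subsp_io N : subsp (@meq n 'I_s) N -> subsp (@feq n 'I_s) (fun p => N (io p)).
Proof.
move=> sN; split.
- exact: (sub_nil sN).
- by move=> p q Np Nq; rewrite /io /iotaM map_cat; apply: (sub_cat sN).
- move=> c p Np; apply: (sub_ev me sN) (sub_scale sN c Np) _ => h _.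
  by rewrite !(ev_scale, ev_iotaM).
- move=> p q /(lc_eqP fe) pq Np; apply: (sub_ev me sN) Np _ => h ih.
  by rewrite !ev_iotaM; apply: pq => x y /eqP ->.
Qed.
Lemma hdeg_io e p : hA e p -> hS e (io p).
Proof.
move=> hp; apply: (hdeg_null gS (q := io (deg_part dA e p))).
  apply: (sub_ev me szS) (null_io (hdeg_deg_part gA hp)) _ => h _.
  by rewrite !(ev_sub, ev_iotaM).
apply: (hdeg_all gS); rewrite all_map; apply: sub_all (all_deg_part dA e p) => -[c [j w]] /=.
by rewrite size_lpmon.
Qed.
(** The embedding is not linear over S. On terms of one degree [e], however, multiplication by a
    word becomes multiplication by that word placed at column [e]. *)
Lemma io_act e y p : all (fun t => dA t.2 == e) p ->
  forall h, ev (io (actl actA y p)) h = ev (actl actS (lpmon e y) (io p)) h.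
Proof.
move=> pe h; rewrite ev_actl !ev_iotaM ev_actl; apply: (eq_ev_all (P := fun x => dA x == e) pe) => x /eqP <-.
by rewrite /actS /= lpmon_cat.
Qed.

Let low (x : 'I_s * cmon n) := has (fun y => y.2 < Delta x.1)%N x.2.
Definition low_part (p : seq (k * ('I_s * cmon n))) := [seq t <- p | low t.2].
Lemma ev_low_part p h : ev (low_part p) h = ev p (fun x => if low x then h x else 0).
Proof. exact: (ev_filter low). Qed.
Lemma null_low_part p : zS p -> zS (low_part p).
Proof.
move=> Zp i; have cP (x y : seq nat) : perm_eq x y -> has (fun c => c < Delta i)%N x = has (fun c => c < Delta i)%N y.
  by move=> xy; apply: perm_has.
apply: (sub_ev ce sS) (SI_filter (chi := has (fun c => c < Delta i)%N) HI cP (Zp i)) _ => h _.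
rewrite (ev_filter (fun u : cmon n => has (fun c => c < Delta i)%N [seq x.2 | x <- u])).
rewrite !ev_comp ev_low_part; apply: eq_ev => x.
by rewrite has_map /low; case: eqP => [->|_]; rewrite ?if_same.
Qed.
Lemma subsp_low_part N : subsp (@meq n 'I_s) N -> subsp (@meq n 'I_s) (fun p => N (low_part p)).
Proof.
move=> sN; split.
- exact: (sub_nil sN).
- by move=> p q Np Nq; rewrite /low_part filter_cat; apply: (sub_cat sN).
- move=> c p Np; apply: (sub_ev me sN) (sub_scale sN c Np) _ => h _.
  by rewrite !(ev_scale, ev_low_part).
- move=> p q /(lc_eqP me) pq Np; apply: (sub_ev me sN) Np _ => h ih.
  rewrite !ev_low_part; apply: pq => x y xy; rewrite (ih _ _ xy) /low.
  by case/andP: xy => /eqP -> /perm_has ->.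
Qed.

Definition unplaceM d := lin (fun x : 'I_s * cmon n =>
  [seq (t.1, (x.1, t.2)) | t <- unplace (k := k) (Delta x.1) d x.2]).
Lemma ev_unplaceM d p h : ev (unplaceM d p) h =
  ev p (fun x => ev (unplace (Delta x.1) d x.2) (fun w => h (x.1, w))).
Proof. by rewrite ev_lin; apply: eq_ev => x; rewrite (ev_map (fun w => (x.1, w))). Qed.
Lemma null_unplaceM d p : zS p -> zA (unplaceM d p).
Proof.
move=> Zp i; apply: (sub_ev we sI) (unplace_SI HI (Delta i) d (Zp i)) _ => h _.
rewrite ev_lin !ev_comp ev_unplaceM; apply: eq_ev => x.
by rewrite (ev_if (x.1 == i)); case: eqP => [->|_] //; rewrite ev_nil.
Qed.
Lemma subsp_unplaceM d N : subsp (@feq n 'I_s) N -> subsp (@meq n 'I_s) (fun p => N (unplaceM d p)).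
Proof.
move=> sN; apply: subsp_lin me fe sN _ => x y /andP[/eqP -> xy]; apply: (lc_eqW fe) => h ih.
rewrite !(ev_map (fun w => (y.1, w))); have /(lc_eqP we) := unplace_perm (k := k) (Delta y.1) d xy.
by apply=> v w /eqP ->.
Qed.

Lemma C_ind N p : subsp (@meq n 'I_s) N -> (forall q, zS q -> N q) ->
  (forall j i c y, (c < Delta j)%N -> N [:: (1, (j, (i, c) :: y))]) -> C p -> N p.
Proof.
move=> sN ZN CN /(sspanE HI) Cp; apply: (gspan_ind_act gS sN ZN _ _ Cp).
- by move=> _ [j [i [c [cj ->]]]]; apply: CN.
- by move=> y _ [j [i [c [cj ->]]]]; apply: CN.
Qed.
Lemma C_low_part p : C p -> zS (lc_sub p (low_part p)).
Proof.
apply: (C_ind (N := fun p => zS (lc_sub p (low_part p)))).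
- split.
  + exact: (sub_nil szS).
  + move=> u v Hu Hv; apply: (sub_ev me szS) (sub_cat szS Hu Hv) _ => h _.
    by rewrite ev_cat !ev_sub !ev_low_part !ev_cat opprD addrACA.
  + move=> c u Hu; apply: (sub_ev me szS) (sub_scale szS c Hu) _ => h _.
    by rewrite !(ev_scale, ev_sub, ev_low_part) mulrBr.
  + move=> u v /(lc_eqP me) uv Hu; apply: (sub_ev me szS) Hu _ => h ih.
    rewrite !(ev_sub, ev_low_part) (uv _ ih); congr (_ - _); apply: uv => x y xy.
    by rewrite (ih _ _ xy) /low; case/andP: xy => /eqP -> /perm_has ->.
- by move=> q Zq; apply: (sub_sub szS) => //; apply: null_low_part.
- move=> j i c y cj; apply: (sub_ev0 me szS) => h _.
  by rewrite ev_sub ev_low_part !ev1 /low /= cj subrr.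
Qed.
Lemma C_unplaceM d p : C p -> zA (unplaceM d p).
Proof.
apply: (C_ind (N := fun p => zA (unplaceM d p))); first exact: subsp_unplaceM.
- by move=> q; apply: null_unplaceM.
- move=> j i c y cj; apply: (sub_ev0 fe szA) => h _; rewrite ev_unplaceM ev1 /= /unplace /=.
  case: ifP => [/and3P[/exact_colsP ex cd _]|_]; last by rewrite ev_nil mulr0.
  by have := ex c cd; rewrite /col /= eqxx /= leqNgt cj.
Qed.
Lemma C_act y p : C p -> C (actl actS y p).
Proof. exact: (sspan_act HI). Qed.

Section Bases.
Variables (BK : seq (k * ('I_s * word n)) -> Prop) (BK' BC : seq (k * ('I_s * cmon n)) -> Prop).
Hypothesis minK : min_hbasis gspA hA (kerA I g) BK.
Hypothesis minK' : min_hbasis gspS hS (kerS I g) BK'.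
Hypothesis minC : min_hbasis gspS hS C BC.
Let TA := augA (kerA I g).
Let TS := augS (kerS I g).
Let TC := augS C.
Let sTA : subsp (@feq n 'I_s) TA := subsp_aug _ _ _ _ _.
Let sTS : subsp (@meq n 'I_s) TS := subsp_aug _ _ _ _ _.
Let sTC : subsp (@meq n 'I_s) TC := subsp_aug _ _ _ _ _.

(** K is graded because it is generated by the homogeneous basis [BK]. *)
Lemma kerA_deg_part e p : kerA I g p -> kerA I g (deg_part dA e p).
Proof. by case: minK => NB hB _ /NB Hp; apply/NB; apply: (gspan_deg_part gA). Qed.

(** A low letter of [y] yields a generator of C, and the word [w] of the term is left over as a
    factor of positive degree. Terms with empty [w] would remain, but they cancel because a syzygy
    of a minimal basis has no constant coefficients. *)
Lemma low_part_io h y : (0 < size y)%N -> kerA I g h -> TC (low_part (actl actS y (io h))).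
Proof.
move=> y0 Kh; pose P (j : 'I_s) := has (fun z => z.2 < Delta j)%N y.
have lowE (x : 'I_s * word n) : low (actS (x.1, lpmon (Delta x.1) x.2) y) = P x.1.
  rewrite /low /= has_cat /P -[X in X || _](has_map (fun z => z.2) (fun c => c < Delta x.1)%N) map_snd_lpmon.
  rewrite (_ : has _ (iota _ _) = false) //; apply/hasPn => c; rewrite mem_iota; lia.
pose f (x : 'I_s * word n) : seq (k * ('I_s * cmon n)) := if (x.2 != [::]) && P x.1 then
  [:: (1, (x.1, lpmon (Delta x.1) x.2 ++ y))] else [::].
apply: (sub_ev me sTC) (sub_lin sTC (f := f) h _) _.
  move=> -[j w]; rewrite /f; case: ifP => [/andP[/= wn]|_]; last by move=> *; apply: (sub_nil sTC).
  case/hasP => -[i c] iy /= cj.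
  have Cg : C [:: (1, (j, [:: (i, c)]))] by apply: ss_gen; exists j, i, c.
  pose y' := rem (i, c) y ++ lpmon (Delta j) w.
  have y'0 : (0 < size y')%N by rewrite size_cat size_lpmon ltn_addl // lt0n size_eq0.
  apply: (sub_ev me sTC) (aug_gen y'0 Cg) _ => hh ih; rewrite ev_actl !ev1; congr (_ * _).
  apply: ih; rewrite /meq eqxx /actS /= perm_sym perm_catC -cat_cons perm_cat2r.
  exact: perm_to_rem.
move=> hh _; rewrite ev_lin ev_low_part ev_actl ev_iotaM.
pose F j := if P j then hh (j, y) else 0.
(* The added sum collects the constant terms of [h], whose coefficients are zero by
   [kerA_const_coef]. *)
transitivity (ev h (fun x => ev (f x) hh + \sum_j F j * (x == (j, [::]))%:R)).
  rewrite ev_add ev_sum [X in _ + X]big1 ?addr0 // => j _.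
  by rewrite ev_mull kerA_const_coef ?mulr0.
apply: eq_ev => -[j w]; rewrite lowE /f /=; have [->|wn] := eqVneq w [::].
  rewrite ev_nil add0r (bigD1 j) //= eqxx mulr1 big1 ?addr0 // => i ij.
  by rewrite xpair_eqE eq_sym (negPf ij) mulr0.
rewrite big1 ?addr0 => [|i _]; last by rewrite xpair_eqE (negPf wn) andbF mulr0.
by case: (P j); rewrite ?ev1 ?ev_nil ?mul1r.
Qed.

(** All placed words of [h] end just before column [e], so one test on [y] decides for all terms. If
    it succeeds, the result is [h] times the nonempty word read from [y]; otherwise it is zero. *)
Lemma unplaceM_io d e h y : (0 < size y)%N -> all (fun t => dA t.2 == e) h -> kerA I g h ->
  TA (unplaceM d (actl actS y (io h))).
Proof.
move=> y0 he Kh.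
pose b := [&& (e <= d)%N, exact_cols e d y & all (fun x => x.2 < d)%N y].
have E hh : ev (unplaceM d (actl actS y (io h))) hh =
    if b then ev (actl actA (colword 0 d y) h) hh else 0.
  rewrite ev_unplaceM !ev_actl ev_iotaM -ev_if; apply: (eq_ev_all (P := fun x => dA x == e) he) => x /eqP xe.
  rewrite /actS /= (unplace_lpmon xe) ?y0 ?orbT // -/b.
  by case: (b); rewrite ?ev1 ?mul1r ?ev_nil.
case: (boolP b) => bt; last by apply: (sub_ev0 fe sTA) => hh _; rewrite E (negPf bt).
have y1 : (0 < size (colword 0 d y))%N.
  case/and3P: bt => _ ex al; rewrite (size_colword ex).
  by rewrite -(size_exact ex al).
by apply: (sub_ev fe sTA) (aug_gen y1 Kh) _ => hh _; rewrite E bt.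
Qed.

Let D d q := TC (low_part q) /\ TA (unplaceM d q).
Lemma subsp_D d : subsp (@meq n 'I_s) (D d).
Proof. by apply: subsp_and; [apply: subsp_low_part|apply: subsp_unplaceM]. Qed.
Lemma null_D d q : zS q -> D d q.
Proof.
by move=> Zq; split; apply: aug_null; [apply: null_low_part|apply: null_unplaceM].
Qed.
Let W q := C q \/ exists2 p, kerA I g p & q = io p.
Lemma kerS_gspan_W q : kerS I g q -> gspS W q.
Proof.
move=> /(kerS_eq_CLK HI Hg)/(sspanE HI); apply: gspan_sub => {}q [Cq|].
  by apply: gspan_gen; left.
by move=> /(sspanE HI); apply: gspan_sub => {}q [p Kp ->]; apply: gspan_gen; right; exists p.
Qed.
Lemma W_D d y q : (0 < size y)%N -> W q -> D d (actl actS y q).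
Proof.
move=> y0 [Cq|[h Kh ->]].
  have Cyq := C_act y Cq; split; last by apply: aug_null; apply: C_unplaceM.
  apply: (sub_subr me sTC (p := actl actS y q)); first by apply: aug_null; apply: C_low_part.
  exact: aug_gen.
have sN : subsp (@feq n 'I_s) (fun h => D d (actl actS y (io h))).
  by apply: (subsp_io (N := fun q => D d (actl actS y q))); apply: (subsp_actl gS); apply: subsp_D.
apply: (sub_deg_parts gA sN) => e; have Kd := kerA_deg_part e Kh; split.
  exact: low_part_io.
exact: (unplaceM_io _ y0 (all_deg_part dA e h)).
Qed.
Lemma TS_D d q : TS q -> D d q.
Proof.
apply; first exact: subsp_D; first exact: null_D.
move=> _ [y [x [Kx y0 ->]]].
apply: (gspan_ind_act gS (W := W) (N := fun x => D d (actl actS y x))) (kerS_gspan_W Kx).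
- by apply: (subsp_actl gS); apply: subsp_D.
- by move=> z Zz; apply: null_D; apply: (gm_null_act gS).
- by move=> z; apply: W_D.
- move=> z w Ww; apply: (sub_ev me (subsp_D d)) (W_D d (y := z ++ y) _ Ww) _.
    by rewrite size_cat ltn_addl.
  by move=> h _; rewrite !ev_actl; apply: eq_ev => x'; rewrite /actS /= catA.
Qed.

Lemma low_part_io0 h : low_part (io h) = [::].
Proof.
rewrite /low_part (@eq_in_filter _ _ pred0) ?filter_pred0 // => _ /mapP[t _ ->] /=.
apply/negP; rewrite /low /= -(has_map (fun z => z.2) (fun c => c < Delta t.2.1)%N) map_snd_lpmon.
by case/hasP => c; rewrite mem_iota => /andP[ge _]; rewrite ltnNge ge.
Qed.
Lemma unplaceM_io_id d h : hA d h -> zA (lc_sub h (unplaceM d (io h))).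
Proof.
move=> hd; have Zh := hdeg_deg_part gA hd.
have Zu := null_unplaceM d (null_io Zh).
apply: (sub_ev fe szA) (sub_sub szA Zh Zu) _ => hh _.
rewrite !(ev_sub, ev_unplaceM, ev_iotaM).
rewrite (_ : ev (deg_part dA d h) (fun x => ev (unplace _ _ _) _) = ev (deg_part dA d h) hh).
  by rewrite opprB addrA subrK.
apply: (eq_ev_all (P := fun x => dA x == d) (all_deg_part dA d h)) => -[j w] /eqP xd /=.
rewrite -[lpmon _ _]cats0 (unplace_lpmon xd) ?leqnn //= andbT.
have -> : exact_cols d d ([::] : cmon n).
  by apply/exact_colsP => c cd; rewrite leqNgt cd.
by rewrite ev1 mul1r colword_nil // cats0.
Qed.

Section Degree.
Variable d : nat.

Lemma BK_finite : exists l : seq (seq (k * ('I_s * word n))),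
  uniq l /\ forall x, x \in l <-> (BK x /\ hA d x).
Proof.
pose w (x : 'I_s * {bseq d of 'I_n}) : seq (k * ('I_s * word n)) := [:: (1, (x.1, val x.2))].
have [|x _ hx|l [ul lP _]] := min_hbasis_finite gA minK (d := d) (w := w) szA; last by exists l.
  by move=> p Zp; apply: aug_null.
have sN := subsp_inspan w fe szA.
apply: (sub_subl fe sN (q := deg_part dA d x)).
  by apply: (inspan_sub _ fe szA); apply: (hdeg_deg_part gA).
apply: (sub_ev fe sN) (sub_lin_all sN (P := fun x => dA x == d) (f := fun x => [:: (1, x)]) (all_deg_part dA d x) _) _.
  move=> [j v] /eqP jv; have vd : (size v <= d)%N by rewrite -jv leq_addl.
  exact: (inspan_gen w (j, Bseq vd) fe szA).
by move=> h _; rewrite ev_lin; apply: eq_ev => y; rewrite ev1 mul1r.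
Qed.

(** The ring S has variables in infinitely many columns, so a bound cannot come from its degree
    part. It comes from the finitely many generators of C, which span C modulo its augmentation
    part. *)
Lemma BC_finite : exists l : seq (seq (k * ('I_s * cmon n))),
  uniq l /\ forall x, x \in l <-> (BC x /\ hS d x).
Proof.
pose M := (\max_j Delta j).+1.
pose w (x : 'I_s * 'I_n * 'I_M) : seq (k * ('I_s * cmon n)) :=
  if (x.2 < Delta x.1.1)%N then [:: (1, (x.1.1, [:: (x.1.2, val x.2)]))] else [::].
have [//|x Bx _|l [ul lP _]] := min_hbasis_finite gS minC (d := d) (w := w) sTC; last by exists l.
have sN := subsp_inspan w me sTC.
have [NB _ _] := minC; have /NB Cx := gspan_gen (eX := @meq n 'I_s) (act := actS) (Z := zS) Bx.
apply: (C_ind sN) Cx => [q Zq|j i c y cj]; first by apply: (inspan_sub _ me sTC); apply: aug_null.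
have [y0|y0] := posnP (size y).
  have cM : (c < M)%N by rewrite ltnS (leq_trans (ltnW cj)) // leq_bigmax.
  have := inspan_gen w (j, i, Ordinal cM) me sTC.
  by rewrite /w /= cj (size0nil y0).
have Cg : C [:: (1, (j, [:: (i, c)]))] by apply: ss_gen; exists j, i, c.
apply: (inspan_sub _ me sTC); exact: (aug_gen y0 Cg).
Qed.

Let B' q := BC q \/ exists2 h, BK h & q = io h.
(** A multiple of a basis element of K is mapped, after passing to its homogeneous representative,
    to an S-multiple of the image of that element, by [io_act]. Hence the images of [BK] generate
    L(K). *)
Lemma kerS_gspan_B' q : kerS I g q <-> gspS B' q.
Proof.
have [NK hK _] := minK; have [NC hC _] := minC.
have sB := subsp_gspan (@meq n 'I_s) actS zS B'.
split=> [/kerS_gspan_W|].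
  apply: gspan_sub => {}q [/NC|[p /NK Kp ->]].
    by apply: gspan_sub => b Bb; apply: gspan_gen; left.
  apply: (gspan_ind_act gA (W := BK) (N := fun p => gspS B' (io p))) Kp.
  - exact: subsp_io.
  - by move=> z Zz; apply: gspan_null; apply: null_io.
  - by move=> b Bb; apply: gspan_gen; right; exists b.
  - move=> y b Bb; have [e he] := hK _ Bb; have Zb := hdeg_deg_part gA he.
    have Z1 := null_io (gm_null_act gA y Zb).
    have Z2 := gm_null_act gS (lpmon e y) (null_io Zb).
    have G1 : gspS B' (actl actS (lpmon e y) (io b)).
      by apply: gspan_act; apply: gspan_gen; right; exists b.
    apply: (sub_ev me sB) (sub_cat sB (gspan_null (sub_sub szS Z1 Z2)) G1) _ => h _.
    rewrite ev_cat ev_sub; have := io_act y (all_deg_part dA e b) h.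
    rewrite !(ev_iotaM, ev_actl, ev_sub) => ->.
    by rewrite opprB addrA subrK subrK.
apply; first exact: subsp_kerS.
- by move=> z; apply: nullS_kerS.
- move=> b [Bb|[h Bh ->]].
    by apply: (kerS_C HI Hg); apply/NC; apply: gspan_gen.
  by apply: (kerS_iotaM HI Hg); apply/NK; apply: gspan_gen.
- by move=> y z; apply: (kerS_act HI).
Qed.

Variables (lK : seq (seq (k * ('I_s * word n)))) (lC : seq (seq (k * ('I_s * cmon n)))).
Hypothesis ulK : uniq lK.
Hypothesis lKP : forall x, x \in lK <-> (BK x /\ hA d x).
Hypothesis ulC : uniq lC.
Hypothesis lCP : forall x, x \in lC <-> (BC x /\ hS d x).
Let vK (i : 'I_(size lK)) := tnth (in_tuple lK) i.
Let vC (i : 'I_(size lC)) := tnth (in_tuple lC) i.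
Let v' (j : 'I_(size lK) + 'I_(size lC)) := match j with inl i => io (vK i) | inr i => vC i end.

Lemma vK_P i : BK (vK i) /\ hA d (vK i). Proof. by apply/lKP; rewrite mem_tnth. Qed.
Lemma vC_P i : BC (vC i) /\ hS d (vC i). Proof. by apply/lCP; rewrite mem_tnth. Qed.
Lemma tnth_uniq_inj (T : eqType) (l : seq T) : uniq l -> injective (tnth (in_tuple l)).
Proof.
case: l => [|x l] ul [i li] [j lj] //; rewrite !(tnth_nth x) /= => /eqP.
by rewrite nth_uniq // => /eqP ij; apply: val_inj.
Qed.

(** The low part kills the images from K and fixes C up to null elements, so the coefficients on C
    vanish first. Reading the remaining relation back as words gives a relation between elements of
    [BK] modulo K A_+. *)
Lemma indep_v' : indep TS v'.
Proof.
move=> c /(TS_D d)[Tlow Tun].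
have cC : forall i, c (inr i) = 0.
  apply: (min_hbasis_indep gS minC (d := d) (v := vC)).
  - exact: tnth_uniq_inj.
  - by move=> i; case: (vC_P i).
  - by move=> i; case: (vC_P i).
  have [NC _ _] := minC.
  have Z1 i : TC (lc_sub (vC i) (low_part (vC i))).
    apply: aug_null; apply: C_low_part; apply/NC; apply: gspan_gen.
    by case: (vC_P i).
  apply: (sub_ev me sTC) (sub_cat sTC Tlow (sub_comb sTC (fun i => c (inr i)) Z1)) _ => h _.
  rewrite ev_cat ev_low_part !ev_comb big_sumType /= [X in X + _ + _]big1 ?add0r.
    rewrite -big_split; apply: eq_bigr => i _ /=; rewrite ev_sub ev_low_part mulrBr.
    by rewrite addrC subrK.
  by move=> i _; rewrite -ev_low_part low_part_io0 ev_nil mulr0.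
have cK : forall i, c (inl i) = 0.
  apply: (min_hbasis_indep gA minK (d := d) (v := vK)).
  - exact: tnth_uniq_inj.
  - by move=> i; case: (vK_P i).
  - by move=> i; case: (vK_P i).
  have Z1 i : TA (lc_sub (vK i) (unplaceM d (io (vK i)))).
    by apply: aug_null; apply: unplaceM_io_id; case: (vK_P i).
  apply: (sub_ev fe sTA) (sub_cat sTA Tun (sub_comb sTA (fun i => c (inl i)) Z1)) _ => h _.
  rewrite ev_cat ev_unplaceM !ev_comb big_sumType /= [X in _ + X + _]big1 ?addr0.
    rewrite -big_split; apply: eq_bigr => i _ /=; rewrite ev_sub ev_unplaceM mulrBr.
    by rewrite addrC subrK.
  by move=> i _; rewrite cC mul0r.
by case.
Qed.

Lemma kerS_inspan (J : finType) (w : J -> seq (k * ('I_s * cmon n))) (B : seq (k * ('I_s * cmon n)) -> Prop) :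
  (forall b, B b -> exists e, hS e b) -> (forall p, kerS I g p <-> gspS B p) ->
  (forall b, B b -> hS d b -> inspan TS w b) ->
  forall p, kerS I g p -> hS d p -> inspan TS w p.
Proof.
move=> hB NB Bw p /NB Bp hp; have sN := subsp_inspan w me sTS.
apply: (gspan_aug gS hB sN _ Bw Bp hp) => q Tq; apply: (inspan_sub _ me sTS).
apply: Tq; first exact: sTS; first by move=> z; apply: aug_null.
by move=> _ [y [x [/NB Kx y0 ->]]]; apply: aug_gen.
Qed.

Lemma inspan_v' p : kerS I g p -> hS d p -> inspan TS v' p.
Proof.
have [_ hK _] := minK; have [_ hC _] := minC.
apply: (kerS_inspan (B := B')) p.
- by move=> b [/hC //|[h /hK[e he] ->]]; exists e; apply: hdeg_io.
- exact: kerS_gspan_B'.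
move=> b [Bb|[h Bh ->]] hb.
  have /(tnthP (in_tuple lC))[i ->] : b \in lC by apply/lCP.
  exact: (inspan_gen v' (inr i) me sTS).
have [e he] := hK _ Bh; have [E|ne] := eqVneq e d.
  have /(tnthP (in_tuple lK))[i ->] : h \in lK by apply/lKP; rewrite -E.
  exact: (inspan_gen v' (inl i) me sTS).
apply: (inspan_sub _ me sTS); apply: aug_null.
exact: (hdeg_unique gS (hdeg_io he) hb).
Qed.

(** Both [v'] and the elements of [BK'] of degree [d] are independent modulo K' S_+, and each family
    spans the other there. The two inequalities between their sizes follow from [indep_le_span]. *)
Lemma BK'_count : bcount hS BK' d (size lK + size lC).
Proof.
have [NK' hK' _] := minK'.
have Bw b : BK' b -> hS d b -> inspan TS v' b.
  by move=> Bb; apply: inspan_v'; apply/NK'; apply: gspan_gen.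
have [//|l [ul lP ls]] := min_hbasis_finite gS minK' sTS _ Bw.
exists l; split=> //; apply/eqP; rewrite eqn_leq -[size lK]card_ord -[size lC]card_ord -card_sum ls /=.
rewrite -[X in (_ <= X)%N]card_ord.
apply: (indep_le_span (v2 := tnth (in_tuple l)) me sTS indep_v') => j.
apply: (kerS_inspan hK' NK').
- move=> b Bb hb; have /(tnthP (in_tuple l))[i ->] : b \in l by apply/lP.
  exact: (inspan_gen _ i me sTS).
- apply/kerS_gspan_B'; apply: gspan_gen; case: j => i; last by left; case: (vC_P i).
  by right; exists (vK i) => //; case: (vK_P i).
- by case: j => i; [apply: hdeg_io; case: (vK_P i)|case: (vC_P i)].
Qed.

End Degree.

Lemma basis_counts d : exists bK bC,
  [/\ bcount hA BK d bK, bcount hS BC d bC & bcount hS BK' d (bK + bC)].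
Proof.
have [lK [ulK lKP]] := BK_finite d; have [lC [ulC lCP]] := BC_finite d.
exists (size lK), (size lC); split; [by exists lK|by exists lC|].
exact: BK'_count.
Qed.
End Bases.
End BasisCounts.

Lemma min_hbasis_ext (E : eqType) (sp sp' : (E -> Prop) -> E -> Prop) hd (N N' B : E -> Prop) :
  (forall G p, sp G p <-> sp' G p) -> (forall p, N p <-> N' p) ->
  min_hbasis sp hd N B -> min_hbasis sp' hd N' B.
Proof.
move=> spE NE [NB hB mB]; split=> // [p|b /mB Hb]; first by rewrite -NE NB spE.
by rewrite -spE.
Qed.

(** * Replacing the generators by congruent representatives *)

Section ChangeOfGenerators.
Context {k : fieldType} {n : nat} (I : seq (k * word n) -> Prop).
Hypothesis HI : is_graded_ideal I.
Variables (r s : nat) (g g' : 'I_s -> seq (k * ('I_r * word n))) (Delta : 'I_s -> nat).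
Hypothesis gg' : forall j, nullA I (lc_sub (g j) (g' j)).
Notation fe := (@feq_equiv n _).
Notation me := (@meq_equiv n _).
Let sA := subsp_nullA HI 'I_r.
Let sS := subsp_nullS I 'I_r.

Lemma phiA_congr p : nullA I (lc_sub (phiA g p) (phiA g' p)).
Proof.
apply: (sub_ev fe sA) (sub_lin sA (f := fun x => actl actA x.2 (lc_sub (g x.1) (g' x.1))) p _) _.
  by move=> x; apply: (gm_null_act (gmA HI (fun=> 0%N))).
move=> h _; rewrite ev_lin ev_sub !ev_phiA -mulN1r -ev_mull -ev_add; apply: eq_ev => x.
by rewrite ev_actl ev_sub mulN1r.
Qed.
Lemma phiS_congr p : nullS I (lc_sub (phiS g p) (phiS g' p)).
Proof.
apply: (sub_ev me sS) (sub_lin sS (f := fun x => actl actS x.2 (iotaM (fun=> 0%N) (lc_sub (g x.1) (g' x.1)))) p _) _.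
  by move=> x; apply: (gm_null_act (gmS HI (fun=> 0%N))); apply: null_iotaM.
move=> h _; rewrite ev_lin ev_sub !ev_phiS -mulN1r -ev_mull -ev_add; apply: eq_ev => x.
by rewrite ev_actl ev_iotaM ev_sub mulN1r.
Qed.
Lemma kerA_congr p : kerA I g p <-> kerA I g' p.
Proof.
rewrite !(kerAE HI); split.
- exact: (sub_subr fe sA (phiA_congr p)).
- exact: (sub_subl fe sA (phiA_congr p)).
Qed.
Lemma kerS_congr p : kerS I g p <-> kerS I g' p.
Proof.
rewrite !kerSE; split.
- exact: (sub_subr me sS (phiS_congr p)).
- exact: (sub_subl me sS (phiS_congr p)).
Qed.
Lemma rspanA_congr j : rspanA I (fun p => exists2 l, l != j & p = g' l) (g' j) ->
  rspanA I (fun p => exists2 l, l != j & p = g l) (g j).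
Proof.
move/(rspanAE HI) => Hj; apply/(rspanAE HI).
have sG := subsp_gspan (@feq n 'I_r) actA (nullA I) (fun p => exists2 l, l != j & p = g l).
apply: (sub_subl fe sG (gspan_null (gg' j))).
apply: gspan_sub Hj => _ [l lj ->].
apply: (sub_subr fe sG (gspan_null (gg' l))).
by apply: gspan_gen; exists l.
Qed.
Lemma sspan_LK_congr p : sspan I (fun q => Cmod I Delta q \/ LK I g Delta q) p ->
  sspan I (fun q => Cmod I Delta q \/ LK I g' Delta q) p.
Proof.
move/(sspanE HI) => Hp; apply/(sspanE HI); apply: gspan_sub Hp => q [Cq|/(sspanE HI) Lq].
  by apply: gspan_gen; left.
apply: gspan_gen; right; apply/(sspanE HI); apply: gspan_sub Lq => _ [u Ku ->].
by apply: gspan_gen; exists u => //; apply/kerA_congr.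
Qed.
End ChangeOfGenerators.

Theorem mainTheorem12 (k : fieldType) (n : nat) (I : seq (k * word n) -> Prop)
  (HI : is_graded_ideal I) (r s : nat)
  (g : 'I_s -> seq (k * ('I_r * word n))) (Delta : 'I_s -> nat)
  (Hhom : forall j, hdegA I (fun _ : 'I_r => 0%N) (Delta j) (g j))
  (Hmin : forall j, ~ rspanA I (fun p => exists2 l, l != j & p = g l) (g j)) :
  (forall p, kerS I g p <-> sspan I (fun q => Cmod I Delta q \/ LK I g Delta q) p) /\
  (forall BK BK' BC,
     min_hbasis (rspanA I) (hdegA I Delta) (kerA I g) BK ->
     min_hbasis (sspan I) (hdegS I Delta) (kerS I g) BK' ->
     min_hbasis (sspan I) (hdegS I Delta) (Cmod I Delta) BC ->
     forall d, exists bK bC,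
       [/\ bcount (hdegA I Delta) BK d bK,
           bcount (hdegS I Delta) BC d bC
         & bcount (hdegS I Delta) BK' d (bK + bC)]).
Proof.
(* The hypothesis gives homogeneity only modulo [I], while placing words in columns requires every
   word of the list for [j] to have length exactly [Delta j]. *)
pose g' j := deg_part (fun x : 'I_r * word n => 0 + size x.2)%N (Delta j) (g j).
have gg' j : nullA I (lc_sub (g j) (g' j)).
  exact: (hdeg_deg_part (gmA HI (fun _ : 'I_r => 0%N)) (Hhom j)).
have g'g j : nullA I (lc_sub (g' j) (g j)).
  apply: (sub_ev (@feq_equiv n _) (subsp_nullA HI _)) (sub_scale (subsp_nullA HI _) (-1) (gg' j)) _ => h _.
  by rewrite ev_scale !ev_sub mulN1r opprB.
have Hg j : all (fun t => size t.2.2 == Delta j) (g' j) by apply: all_deg_part.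
have Hmin' j : ~ rspanA I (fun p => exists2 l, l != j & p = g' l) (g' j).
  by move/(rspanA_congr HI gg')/Hmin.
split=> [p|BK BK' BC mK mK' mC d].
  rewrite (kerS_congr HI gg') (kerS_eq_CLK HI Hg).
  by split; apply: (sspan_LK_congr HI).
apply: (basis_counts HI Hg Hmin').
- by apply: min_hbasis_ext mK => *; [apply: (rspanAE HI)|apply: (kerA_congr HI)].
- by apply: min_hbasis_ext mK' => *; [apply: (sspanE HI)|apply: (kerS_congr HI)].
- by apply: min_hbasis_ext mC => // *; apply: (sspanE HI).
Qed.
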